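(* For all integers $n>m>0$, a simplex $\Delta$ in $\mathbf{H}^n\sqcup\partial\mathbf{H}^n$ satisfies $\delta^n_m(\Delta)=\mu^n_m$ if and only if $\Delta$ is total, ideal and regular. Moreover, for every $n\ge 2$, $\mu^n_1$ is given by $$\left(\tanh\mu^n_1\right)^2=\frac{n-1}{2n},$$ so $\mu^n_1$ increases with $n$ and converges as $n\to\infty$ to $\mu^\infty_1=\tanh^{-1}(1/\sqrt2)=\log(1+\sqrt2)$.
   Context: $\mathbf{H}^n$ is real hyperbolic space of dimension $n$ (curvature $-1$) with distance $d$ and isometry group $\operatorname{Isom}(\mathbf{H}^n)$; $\partial\mathbf{H}^n$ is its boundary at infinity, and $\mathbf{H}^n\sqcup\partial\mathbf{H}^n$ is the compactification. In the projective (Cayley–Klein) model, $\mathbf{H}^n$ is the open unit ball of $\mathbb{R}^n$, $\partial\mathbf{H}^n$ is the unit sphere, and geodesic subspaces and convex hulls are the Euclidean ones. A simplex $\Delta$ is a sequence of $n+1$ points $v_0,\dots,v_n$ of $\mathbf{H}^n\sqcup\partial\mathbf{H}^n$, its vertices (not necessarily distinct or independent). It is ideal when all $v_i\in\partial\mathbf{H}^n$. It is total when its vertices are independent (affinely independent in the projective ball model), equivalently when their convex hull has non-empty interior. A total simplex is regular when its stabilizer in $\operatorname{Isom}(\mathbf{H}^n)$ (the isometries preserving the set of vertices) acts transitively on its flags of faces, i.e. realizes the full symmetric group $\mathfrak{S}_{n+1}$ of permutations of its vertices. For $0\le m\le n$, an $m$-face of $\Delta$ is the convex hull of $1+m$ of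 its vertices, and the $m$-skeleton $\Delta^{(m)}$ is the union of its $m$-faces; in particular $\Delta^{(n)}$ is the convex hull of all the vertices. Define $\delta^n_m(\Delta)=\max\{d(p,\Delta^{(m)}) : p\in\Delta^{(n)}\}$, where distances are computed in $\mathbf{H}^n$ (between points of $\Delta^{(n)}\cap\mathbf{H}^n$ and the set $\Delta^{(m)}\cap\mathbf{H}^n$; the value is $0$ when $\Delta^{(n)}\cap\mathbf{H}^n$ is empty). Finally $\mu^n_m=\max_\Delta\delta^n_m(\Delta)\in[0,\infty]$, the maximum over all simplices $\Delta\in(\mathbf{H}^n\sqcup\partial\mathbf{H}^n)^{n+1}$. *)

(* Defs.v *)
From HB Require Import structures.
From mathcomp Require Export all_boot all_order all_fingroup all_algebra.
From mathcomp Require Export all_classical all_reals all_analysis.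
From mathcomp Require Import ring lra.

Set Implicit Arguments.
Unset Strict Implicit.
Unset Printing Implicit Defensive.

Export Order.TTheory GRing.Theory Num.Theory.
Export numFieldNormedType.Exports.

Global Open Scope classical_set_scope.
Global Open Scope ring_scope.

Section HyperbolicFunctions.
Context {R : realType}.
Implicit Types x t : R.

Definition cosh x : R := (expR x + expR (- x)) / 2.
Definition sinh x : R := (expR x - expR (- x)) / 2.
Definition tanh x : R := sinh x / cosh x.

Definition arcosh t : R := ln (t + Num.sqrt (t ^+ 2 - 1)).
Definition artanh t : R := ln ((1 + t) / (1 - t)) / 2.

Lemma arcoshK t : 1 <= t -> 0 <= arcosh t /\ cosh (arcosh t) = t.
Proof.
move=> t1; rewrite /arcosh /cosh.
have h0 : 0 <= t ^+ 2 - 1 by rewrite subr_ge0 expr_ge1 // (le_trans ler01).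
have s0 := sqrtr_ge0 (t ^+ 2 - 1).
have u1 : 1 <= t + Num.sqrt (t ^+ 2 - 1) by rewrite -[1]addr0 lerD.
have u0 := lt_le_trans ltr01 u1.
split; first exact: ln_ge0.
rewrite expRN lnK ?posrE //.
have -> : (t + Num.sqrt (t ^+ 2 - 1))^-1 = t - Num.sqrt (t ^+ 2 - 1).
  apply: (mulfI (lt0r_neq0 u0)); rewrite mulfV ?lt0r_neq0 //.
  by rewrite mulrC -subr_sqr sqr_sqrtr // opprB addrC subrK.
by field.
Qed.

Lemma artanhK t : -1 < t < 1 -> tanh (artanh t) = t.
Proof.
move=> /andP[tN1 t1].
have a0 : 0 < 1 + t by rewrite -(opprK 1) addrC subr_gt0.
have b0 : 0 < 1 - t by rewrite subr_gt0.
set u := expR (artanh t).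
have u0 : u != 0 by rewrite gt_eqF ?expR_gt0.
have uu : u ^+ 2 = (1 + t) / (1 - t).
  rewrite -expRM_natl mulr_natl -mulr_natr /artanh mulfVK ?pnatr_eq0 //.
  by rewrite lnK // posrE divr_gt0.
have -> : tanh (artanh t) = (u ^+ 2 - 1) / (u ^+ 2 + 1).
  have k0 : 1 + u ^+ 2 != 0 by rewrite gt_eqF // ltr_pwDl // sqr_ge0.
  by rewrite /tanh /sinh /cosh expRN -/u; field; rewrite addrC k0 u0.
by rewrite uu; field; rewrite gt_eqF //=; apply/eqP; lra.
Qed.

End HyperbolicFunctions.

(* The projective (Cayley-Klein) model in R^n = 'rV[R]_n. *)
Section KleinModel.
Context {R : realType} {n : nat}.
Implicit Types x y p : 'rV[R]_n.

Definition dotv x y : R := (x *m y^T) 0 0.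

Definition Hyp : set 'rV[R]_n := [set x | dotv x x < 1].
Definition bdHyp : set 'rV[R]_n := [set x | dotv x x = 1].
Definition cptHyp : set 'rV[R]_n := Hyp `|` bdHyp.

(* Only meaningful for x and y in Hyp; the argument of arcosh is minus the
   Lorentz product of the lifts of x and y to the hyperboloid. *)
Definition hdist x y : R :=
  arcosh ((1 - dotv x y) /
          (Num.sqrt (1 - dotv x x) * Num.sqrt (1 - dotv y y))).

Definition hdist_set p (A : set 'rV[R]_n) : \bar R :=
  ereal_inf [set (hdist p q)%:E | q in A `&` Hyp].

(* An isometry of hyperbolic space together with its action at infinity,
   which is its unique continuous extension to the closed ball (values outside
   the closed ball are irrelevant). *)
Definition hyp_isometry (g : 'rV[R]_n -> 'rV[R]_n) : Prop :=
  [/\ set_bij Hyp Hyp g,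
      {in Hyp &, forall x y, hdist (g x) (g y) = hdist x y} &
      {within cptHyp, continuous g}].

End KleinModel.

Section Simplices.
Context {R : realType} {n : nat}.
Implicit Types (v : 'I_n.+1 -> 'rV[R]_n) (I : {set 'I_n.+1}) (m : nat).

Definition simplex v : Prop := forall i, cptHyp (v i).

Definition ideal_simplex v : Prop := forall i, bdHyp (v i).

(* Affine independence of the vertices. *)
Definition total_simplex v : Prop :=
  forall c : 'I_n.+1 -> R,
    \sum_i c i = 0 -> \sum_i c i *: v i = 0 -> forall i, c i = 0.

Definition regular_simplex v : Prop :=
  forall s : 'S_n.+1,
    exists2 g, hyp_isometry g & forall i, g (v i) = v (s i).

Definition face v I : set 'rV[R]_n :=
  [set x | exists c : 'I_n.+1 -> R,
     [/\ forall i, 0 <= c i, \sum_(i in I) c i = 1 &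
         x = \sum_(i in I) c i *: v i]].

Definition skeleton m v : set 'rV[R]_n :=
  \bigcup_(I in [set I : {set 'I_n.+1} | #|I| = m.+1]) face v I.

(* The distances of which delta is the maximum. Distances being nonnegative,
   adding 0 only matters if the simplex does not meet Hyp, in which case delta
   is 0 by convention. *)
Definition depths m v : set (\bar R) :=
  [set 0%E] `|` [set hdist_set p (skeleton m v) | p in skeleton n v `&` Hyp].

Definition delta m v : \bar R := ereal_sup (depths m v).

End Simplices.

Definition mu (R : realType) (n m : nat) : \bar R :=
  ereal_sup [set delta m v | v in @simplex R n].

(* Main.v *)
(** Move an interior point p of the simplex to the origin of the Klein ball. Then
  |x| = tanh d(0, x), and the claim becomes a Euclidean one: if 0 is a convex
  combination of n + 1 points of the closed unit ball, then some convex
  combination of m + 1 of them has norm squared at most (n - m) / (n (m + 1)).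
  Descend one dimension at a time: replace the current point of a k-face by the
  point of least norm of that face and discard its vertex of smallest
  barycentric coordinate, which is at most 1 / (k + 1). First-order optimality
  shows that 1 - |x|^2 is multiplied by at least 1 - 1 / k^2, and the product
  telescopes. In the case of equality all coordinates of p are 1 / (n + 1) and
  the vertices are unit vectors with pairwise products - 1 / n.

  In place of moving p one rescales the Lorentz Gram matrix of the vertices. The
  extremal simplices are then the [balanced] ones, whose Gram matrix has entries
  u_i u_j off the diagonal and 0 on it. Such simplices are total and ideal, any
  permutation of their vertices is induced by a Lorentz transformation, and the
  Gram matrix determines the distances from the centroid. Conversely, isometries
  preserve the cross-ratios of points at infinity, and if all transpositions of
  the vertices of an ideal simplex are realized, these cross-ratios equal 1,
  which makes the simplex balanced. *)

Require Import Defs.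
From mathcomp Require Import ring lra.

Set Implicit Arguments.
Unset Strict Implicit.
Unset Printing Implicit Defensive.

(** * Maximizing a quadratic form over faces of the weight simplex *)

Lemma cvg_sumr (R : realType) (T : Type) (F : set_system T) (I : Type)
    (r : seq I) (P : pred I) (f : I -> T -> R) (l : I -> R) :
  Filter F -> (forall i, P i -> f i x @[x --> F] --> l i) ->
  (\sum_(i <- r | P i) f i x) @[x --> F] --> \sum_(i <- r | P i) l i.
Proof.
move=> FF fl; apply: cvg_big => //.
exact: add_continuous.
Qed.

Lemma continuous_sumr (R : realType) (T : topologicalType) (I : Type)
    (r : seq I) (P : pred I) (f : I -> T -> R) :
  (forall i, P i -> continuous (f i)) ->
  continuous (fun x => \sum_(i <- r | P i) f i x).
Proof. by move=> fc x; apply: (@cvg_sumr _ _ (nbhs x)) => i /fc; exact. Qed.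

Lemma continuous_mulr (R : realType) (T : topologicalType) (f h : T -> R) :
  continuous f -> continuous h -> continuous (fun x => f x * h x).
Proof. by move=> fc hc x; apply: continuousM; [exact: fc|exact: hc]. Qed.

Lemma continuous_addr (R : realType) (T : topologicalType) (f h : T -> R) :
  continuous f -> continuous h -> continuous (fun x => f x + h x).
Proof. by move=> fc hc x; apply: continuousD; [exact: fc|exact: hc]. Qed.

Section BilinearForms.
Context {R : comNzRingType} {n : nat}.
Implicit Types (g : 'M[R]_n) (x y z : 'rV[R]_n).

Definition bil g x y : R := (x *m g *m y^T) 0 0.

Lemma bilDl g x y z : bil g (x + y) z = bil g x z + bil g y z.
Proof. by rewrite /bil !mulmxDl mxE. Qed.

Lemma bilDr g x y z : bil g z (x + y) = bil g z x + bil g z y.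
Proof. by rewrite /bil linearD mulmxDr mxE. Qed.

Lemma bilZl g a x y : bil g (a *: x) y = a * bil g x y.
Proof. by rewrite /bil -!scalemxAl mxE. Qed.

Lemma bilZr g a x y : bil g x (a *: y) = a * bil g x y.
Proof. by rewrite /bil linearZ /= -scalemxAr mxE. Qed.

Lemma bilC g x y : g^T = g -> bil g x y = bil g y x.
Proof.
move=> gT; transitivity ((y *m g *m x^T)^T 0 0); last by rewrite mxE.
by rewrite /bil !trmx_mul trmxK gT mulmxA.
Qed.

Lemma bil_suml g (I : Type) (r : seq I) (P : pred I) (F : I -> 'rV[R]_n) y :
  bil g (\sum_(i <- r | P i) F i) y = \sum_(i <- r | P i) bil g (F i) y.
Proof. by rewrite /bil !mulmx_suml summxE. Qed.

Lemma bil_sumr g (I : Type) (r : seq I) (P : pred I) (F : I -> 'rV[R]_n) x :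
  bil g x (\sum_(i <- r | P i) F i) = \sum_(i <- r | P i) bil g x (F i).
Proof. by rewrite /bil linear_sum /= mulmx_sumr summxE. Qed.

Lemma bilE g x y : bil g x y = \sum_i \sum_j x 0 i * y 0 j * g i j.
Proof.
rewrite /bil mxE exchange_big; apply: eq_bigr => j _ /=.
rewrite !mxE mulr_suml; apply: eq_bigr => i _; ring.
Qed.

Lemma bil_delta g i j : bil g (delta_mx 0 i) (delta_mx 0 j) = g i j.
Proof. by rewrite /bil -rowE trmx_delta -colE !mxE. Qed.

Lemma bil_deltaE g i x : bil g (delta_mx 0 i) x = \sum_j x 0 j * g i j.
Proof.
rewrite {1}(row_sum_delta x) bil_sumr; apply: eq_bigr => j _.
by rewrite bilZr bil_delta.
Qed.

End BilinearForms.

Section Weights.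
Context {R : realType} {N : nat}.
Implicit Types (S : {set 'I_N}) (c d : 'rV[R]_N) (g : 'M[R]_N).

(** Barycentric coordinates carried by [S]. They are row vectors, so that compactness and
    coordinatewise continuity apply, and they vanish outside [S], so that all faces share one
    coordinate space. *)
Definition weight S c : Prop :=
  [/\ forall i, 0 <= c 0 i, \sum_i c 0 i = 1 & forall i, i \notin S -> c 0 i = 0].

Lemma weight_le1 S c i : weight S c -> c 0 i <= 1.
Proof.
case=> c0 <- _; rewrite (bigD1 i) //= lerDl; exact: sumr_ge0.
Qed.

Lemma weight_supp S c : weight S c -> \sum_(i in S) c 0 i = 1.
Proof.
case=> _ <- cS; rewrite [RHS](bigID (mem S)) /= [X in _ + X]big1 ?addr0 //.
Qed.

Lemma weight_sub S (T : {set 'I_N}) c : S \subset T -> weight S c -> weight T c.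
Proof.
move=> /fintype.subsetP ST [c0 c1 cS]; split=> // i iT; apply: cS.
by apply: contra iT; apply: ST.
Qed.

Lemma weight_conv S c d t : weight S c -> weight S d -> 0 <= t <= 1 ->
  weight S ((1 - t) *: c + t *: d).
Proof.
move=> [c0 c1 cS] [d0 d1 dS] /andP[t0 t1]; split=> [i||i iS].
- by rewrite !mxE addr_ge0 // mulr_ge0 // subr_ge0.
- under eq_bigr do rewrite !mxE.
  by rewrite big_split /= -!mulr_sumr c1 d1; ring.
- by rewrite !mxE cS // dS // !mulr0 addr0.
Qed.

Lemma weight_delta S i : i \in S -> weight S (delta_mx 0 i : 'rV[R]_N).
Proof.
move=> iS; split=> [j||j jS].
- by rewrite mxE; case: (_ && _).
- rewrite (bigD1 i) //= big1 ?addr0; first by rewrite mxE !eqxx.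
  by move=> j /negbTE ji; rewrite mxE ji andbF.
- rewrite mxE; case: eqP => //= _; case: eqP => // ji.
  by rewrite ji iS in jS.
Qed.

Lemma weight_compact S : compact [set c | weight S c].
Proof.
pose A i : set R := if i \in S then `[0, 1]%classic else [set 0].
have cA : compact [set c : 'rV[R]_N | forall i, A i (c ord0 i)].
  apply: rV_compact => i; rewrite /A; case: ifP => _.
    exact: segment_compact.
  exact: compact_set1.
have cB : closed ((fun c : 'rV[R]_N => \sum_i c 0 i) @^-1` [set 1]).
  apply: closed_comp; last exact: closed_eq.
  move=> c _; apply: continuous_sumr => i _; exact: coord_continuous.
suff -> : [set c | weight S c] = [set c : 'rV[R]_N | forall i, A i (c ord0 i)]
    `&` ((fun c : 'rV[R]_N => \sum_i c 0 i) @^-1` [set 1]).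
  exact: compact_closedI.
apply/seteqP; split=> c /=.
  move=> wc; have [c0 c1 cS] := wc; split=> // i; rewrite /A.
  case: ifPn => iS /=; last exact: cS.
  by rewrite in_itv /= c0 (weight_le1 _ wc).
move=> [Ac c1]; split=> // i => [|iS]; have := Ac i; rewrite /A.
  by case: ifP => _ /=; [rewrite in_itv /= => /andP[]|move=> ->].
by rewrite (negbTE iS).
Qed.

Lemma bil_continuous g : continuous (fun c => bil g c c).
Proof.
have -> : (fun c => bil g c c) =
    (fun c => \sum_i \sum_j c 0 i * c 0 j * g i j).
  by apply/funext => c; rewrite bilE.
apply: continuous_sumr => i _; apply: continuous_sumr => j _.
apply: continuous_mulr; last exact: cst_continuous.
by apply: continuous_mulr; exact: coord_continuous.
Qed.

Lemma weight_max S g : S != finset.set0 ->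
  exists2 c, weight S c & forall d, weight S d -> bil g d d <= bil g c c.
Proof.
move=> /finset.set0Pn[i iS].
have A0 : [set c | weight S c] !=set0.
  by exists (delta_mx 0 i); exact: weight_delta.
have [c cS cmax] := compact_EVT_max A0 (@weight_compact S)
  (continuous_subspaceT (@bil_continuous g)).
by exists c => [|d dS]; [rewrite inE in cS|apply: cmax; rewrite inE].
Qed.

(** The derivative of the form at [c] towards [d] is [2 (bil g d c - bil g c c)]; at a maximizer it
    cannot be positive, whatever the signature of [g]. *)
Lemma weight_first_order S g c d : g^T = g -> weight S c -> weight S d ->
  (forall d, weight S d -> bil g d d <= bil g c c) ->
  bil g d c <= bil g c c.
Proof.
move=> gT cS dS cmax; rewrite leNgt; apply/negP => lt.
set h := bil g d c in lt *; set G := bil g c c in lt *.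
set X := `|2 * h - G - bil g d d|.
have X0 : 0 <= X by exact: normr_ge0.
have D0 : 0 < 1 + (h - G) + X by lra.
(* This choice ensures [t <= 1] and [t * X < h - G], whereas maximality tested at time [t] gives
   [2 * (h - G) <= t * X]. *)
pose t := (h - G) / (1 + (h - G) + X).
have tE : t * (1 + (h - G) + X) = h - G by rewrite /t mulfVK ?gt_eqF.
have t0 : 0 < t by rewrite /t divr_gt0 ?subr_gt0.
have t1 : t <= 1 by rewrite ler_pdivrMr // mul1r; lra.
have := cmax _ (weight_conv cS dS _ : weight S ((1 - t) *: c + t *: d)).
rewrite (ltW t0) t1 => /(_ isT).
rewrite !(bilDl, bilDr, bilZl, bilZr) (bilC c d gT) -/h -/G => le.
have le' : t * (2 * (h - G)) <= t * (t * (2 * h - G - bil g d d)) by nra.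
rewrite ler_pM2l // in le'.
have : t * (2 * h - G - bil g d d) <= t * X by rewrite ler_pM2l // ler_norm.
nra.
Qed.

(** The line from vertex [i] through [c] meets the opposite facet in this point. *)
Lemma weight_remove S c i : weight S c -> i \in S -> c 0 i < 1 ->
  weight (S :\ i) ((1 - c 0 i)^-1 *: (c - c 0 i *: delta_mx 0 i)).
Proof.
move=> [c0 c1 cS] iS lt1; have u0 : 0 < 1 - c 0 i by rewrite subr_gt0.
split=> [j||j].
- rewrite !mxE eqxx /=; apply: mulr_ge0; first by rewrite invr_ge0 ltW.
  by case: eqP => [->|_]; rewrite ?mulr1 ?subrr ?mulr0 ?subr0.
- under eq_bigr do rewrite !mxE eqxx /=.
  rewrite -mulr_sumr sumrB c1 (bigD1 i) //= eqxx mulr1 big1 ?addr0.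
    by rewrite mulVf ?gt_eqF.
  by move=> j /negbTE ->; rewrite mulr0.
- rewrite !inE negb_and negbK !mxE eqxx /=; case: eqP => [->|_] /=.
    by rewrite mulr1 subrr mulr0.
  by move=> /cS ->; rewrite !mulr0 subr0 mulr0.
Qed.

Lemma weight_min S c k : weight S c -> #|S| = k.+1 ->
  exists2 i, i \in S & (forall j, j \in S -> c 0 i <= c 0 j) /\
                       c 0 i <= (k.+1%:R)^-1.
Proof.
move=> cS Sk; have /finset.set0Pn[i0 i0S] : S != finset.set0.
  by rewrite -finset.card_gt0 Sk.
have [i iS imin] := arg_minP (fun i => c 0 i) i0S.
exists i => //; split=> //.
rewrite -[leRHS]div1r ler_pdivlMr ?ltr0n // -[leRHS](weight_supp cS).
apply: le_trans (_ : \sum_(j in S) c 0 i <= _); last exact: ler_sum.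
by rewrite sumr_const Sk mulr_natr.
Qed.

Lemma bil_remove g c i : g^T = g -> c 0 i < 1 ->
  let y := (1 - c 0 i)^-1 *: (c - c 0 i *: delta_mx 0 i) in
  bil g y y = (bil g c c - 2 * c 0 i * bil g (delta_mx 0 i) c
               + c 0 i ^+ 2 * g i i) / (1 - c 0 i) ^+ 2.
Proof.
move=> gT lt1 y; rewrite /y -scaleNr !(bilDl, bilDr, bilZl, bilZr) bil_delta.
rewrite (bilC c (delta_mx _ _) gT); field.
by rewrite gt_eqF // subr_gt0.
Qed.

Lemma remove_ratio k (a : R) : (0 < k)%N -> 0 <= a <= k.+1%:R^-1 ->
  a < 1 /\ (a / (1 - a)) ^+ 2 <= k%:R^-1 ^+ 2 :> R.
Proof.
move=> k0 /andP[a0 a1]; have kR : (0 < k%:R :> R) by rewrite ltr0n.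
have : a * k.+1%:R <= 1 by rewrite -ler_pdivlMr ?ltr0n // div1r.
rewrite -natr1 => ak.
have lt1 : a < 1 by nra.
split=> //; have u0 : 0 < 1 - a by rewrite subr_gt0.
have le1 : a / (1 - a) <= k%:R^-1.
  rewrite ler_pdivrMr // -ler_pdivrMl ?invr_gt0 // invrK; lra.
by apply: lerXn2r; rewrite ?nnegrE ?invr_ge0 ?divr_ge0 ?ler0n ?(ltW u0).
Qed.

(* A maximizer [c] of the form on the face [S] satisfies (gc)_i <= bil g c c,
   so discarding the vertex of smallest weight loses a factor at most
   [1 - 1 / k ^ 2]. *)
Lemma face_step S g k c0 : (0 < k)%N -> #|S| = k.+1 -> g^T = g ->
  (forall i, 0 <= g i i) -> weight S c0 ->
  exists S' c', [/\ S' \subset S, #|S'| = k, weight S' c' &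
    bil g c0 c0 * (1 - k%:R^-1 ^+ 2) <= bil g c' c'].
Proof.
move=> k0 Sk gT g0 wc0; have [|c wc cmax] := @weight_max S g.
  by rewrite -finset.card_gt0 Sk.
have [i iS [_ cik]] := weight_min wc Sk.
have ci0 : 0 <= c 0 i by case: wc.
have [lt1 rat] := @remove_ratio k (c 0 i) k0 (introT andP (conj ci0 cik)).
have wi := weight_delta iS.
exists (S :\ i), ((1 - c 0 i)^-1 *: (c - c 0 i *: delta_mx 0 i)); split.
- exact: subD1set.
- by have := cardsD1 i S; rewrite iS Sk => -[].
- exact: weight_remove.
have k1 : k%:R^-1 ^+ 2 <= 1 :> R.
  by rewrite expr_le1 ?invr_ge0 ?ler0n // invf_le1 ?ltr0n // ler1n.
apply: (@le_trans _ _ (bil g c c * (1 - k%:R^-1 ^+ 2))).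
  by rewrite ler_wpM2r ?subr_ge0 // cmax.
have G0 : 0 <= bil g c c by apply: le_trans (cmax _ wi); rewrite bil_delta.
apply: (@le_trans _ _ (bil g c c * (1 - (c 0 i / (1 - c 0 i)) ^+ 2))).
  by rewrite ler_wpM2l // lerB.
rewrite bil_remove // ler_pdivlMr ?exprn_gt0 ?subr_gt0 //.
have fo := weight_first_order gT wc wi cmax.
have gi := g0 i.
have u0 : 1 - c 0 i != 0 by rewrite gt_eqF ?subr_gt0.
rewrite -[leLHS]mulrA.
(* The numerator is at least [bil g c c * (1 - 2 * c 0 i)]: first-order optimality bounds the linear
   term, and [g i i >= 0] the quadratic one. *)
have -> : (1 - (c 0 i / (1 - c 0 i)) ^+ 2) * (1 - c 0 i) ^+ 2 = 1 - 2 * c 0 i.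
  by field.
have := sqr_ge0 (c 0 i); nra.
Qed.

(** By [(1 - 1 / (k + 1) ^ 2) (1 + 1 / k) = 1 + 1 / (k + 1)], a descent from dimension [k + 1] to
    [k] does not decrease the value of the form times [1 + 1 / dimension]. *)
Lemma face_chain m j S g c : (0 < m)%N -> #|S| = (m + j).+1 -> g^T = g ->
  (forall i, 0 <= g i i) -> weight S c ->
  exists S' c', [/\ S' \subset S, #|S'| = m.+1, weight S' c' &
    bil g c c * (1 + (m + j)%:R^-1) <= bil g c' c' * (1 + m%:R^-1)].
Proof.
move=> m0; elim: j S c => [|j IH] S c Sk gT g0 wc.
  by rewrite addn0 in Sk *; exists S, c; split.
have [|S1 [c1 [S1S S1k wc1 le1]]] := @face_step S g (m + j.+1) c _ Sk gT g0 wc.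
  by rewrite addn_gt0 m0.
rewrite addnS in S1k.
have [S2 [c2 [S2S S2k wc2 le2]]] := IH S1 c1 S1k gT g0 wc1.
exists S2, c2; split=> //; first exact: fintype.subset_trans S1S.
apply: le_trans le2; rewrite addnS.
have kR : (0 < (m + j)%:R :> R) by rewrite ltr0n addn_gt0 m0.
have u0 : (0 < 1 + (m + j)%:R^-1 :> R) by rewrite addr_gt0 ?invr_gt0.
apply: (@le_trans _ _ (bil g c c * (1 - (m + j.+1)%:R^-1 ^+ 2) *
   (1 + (m + j)%:R^-1))); last by rewrite ler_pM2r.
rewrite -mulrA addnS -natr1 le_eqVlt; apply/orP; left; apply/eqP.
congr (_ * _); field; rewrite !gt_eqF //; lra.
Qed.

End Weights.

(** * Rigidity of the forms for which the descent is sharp *)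

Section Extremal.
Context {R : realType} {n : nat}.
Implicit Types (g : 'M[R]_n.+1) (c d : 'rV[R]_n.+1) (S : {set 'I_n.+1}).

(** The inequalities of the descent become equalities. A vertex of weight at most [1 / (n + 1)] has
    exactly this weight and a zero diagonal entry; for the smallest weight this forces all weights
    to be equal. The center of each facet then maximizes the form there, so first-order optimality
    gives [g i j >= 1 + 1 / n], and the condition on row [i] turns these into equalities. *)
Lemma facet_extremal g c : (1 < n)%N -> g^T = g -> (forall i, 0 <= g i i) ->
  weight [set: 'I_n.+1]%SET c -> (forall i, bil g (delta_mx 0 i) c = 1) ->
  (forall S d, #|S| = n -> weight S d -> bil g d d <= 1 - n%:R^-1 ^+ 2) ->
  forall i, g i i = 0 /\ forall j, j != i -> g i j = 1 + n%:R^-1.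
Proof.
move=> n1 gT g0 wc gc max; have n0 : (0 < n)%N by exact: ltnW.
have nR : (0 < n%:R :> R) by rewrite ltr0n.
have cardT i : #|[set: 'I_n.+1]%SET :\ i| = n.
  by have := cardsD1 i [set: 'I_n.+1]%SET; rewrite finset.in_setT cardsT card_ord => -[].
have [c0 c1 _] := wc.
have Gc : bil g c c = 1.
  rewrite {1}(row_sum_delta c) bil_suml -c1; apply: eq_bigr => i _.
  by rewrite bilZl gc mulr1.
have remove i : c 0 i < 1 ->
    1 - c 0 i ^+ 2 * (1 - g i i) / (1 - c 0 i) ^+ 2 <= 1 - n%:R^-1 ^+ 2.
  move=> lt1; apply: le_trans (max _ _ (cardT i) (weight_remove wc _ lt1)); last first.
    by rewrite finset.in_setT.
  rewrite bil_remove // Gc gc le_eqVlt; apply/orP; left; apply/eqP.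
  by field; rewrite gt_eqF // subr_gt0.
have key i : c 0 i <= n.+1%:R^-1 -> c 0 i = n.+1%:R^-1 /\ g i i = 0.
  move=> ci; have [lt1 _] := @remove_ratio R n (c 0 i) n0 (introT andP (conj (c0 i) ci)).
  have u0 : 0 < 1 - c 0 i by rewrite subr_gt0.
  have := remove i lt1; rewrite lerD2l lerN2 ler_pdivlMr ?exprn_gt0 // => le.
  have {le} : (1 - c 0 i) ^+ 2 <= n%:R ^+ 2 * (c 0 i ^+ 2 * (1 - g i i)).
    by rewrite -ler_pdivrMl ?exprn_gt0 // -exprVn.
  have : c 0 i * n.+1%:R <= 1 by rewrite -ler_pdivlMr ?ltr0n // div1r.
  rewrite -natr1 => nc le.
  have gi := g0 i; have ci0 := c0 i.
  (* One inequality is [c 0 i <= 1 / (n + 1)]; the other is the facet bound combined with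
     [1 - g i i <= 1]. *)
  have e1 : c 0 i * n%:R = 1 - c 0 i.
    apply/eqP; rewrite eq_le; apply/andP; split; first lra.
    rewrite -(@ler_pXn2r _ 2) ?nnegrE ?mulr_ge0 ?(ltW u0) ?(ltW nR) //.
    apply: le_trans le _; rewrite exprMn mulrA [n%:R ^+ 2 * _]mulrC.
    by rewrite ler_piMr ?mulr_ge0 ?sqr_ge0 // gerBl.
  split.
    apply: (@mulIf _ (n%:R + 1)); first by rewrite natr1 pnatr_eq0.
    rewrite mulVf ?natr1 ?pnatr_eq0 // -natr1; lra.
  move: le; rewrite mulrA [n%:R ^+ 2 * _]mulrC -exprMn e1.
  rewrite -{1}[(1 - c 0 i) ^+ 2]mulr1 ler_pM2l ?exprn_gt0 // => le.
  by apply/eqP; rewrite eq_le gi andbT; lra.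
have [i0 _ [imin ci0]] : exists2 i, i \in [set: 'I_n.+1]%SET &
    (forall j, j \in [set: 'I_n.+1]%SET -> c 0 i <= c 0 j) /\ c 0 i <= n.+1%:R^-1.
  by apply: weight_min => //; rewrite cardsT card_ord.
have [ci0E _] := key _ ci0.
have cE i : c 0 i = n.+1%:R^-1.
  have ge j : n.+1%:R^-1 <= c 0 j by rewrite -ci0E imin ?finset.in_setT.
  have : \sum_j (c 0 j - n.+1%:R^-1) = 0.
    rewrite sumrB c1 sumr_const card_ord -[n.+1%:R^-1 *+ _]mulr_natr.
    by rewrite mulVf ?pnatr_eq0 // subrr.
  move/eqP; rewrite psumr_eq0 => [/allP/(_ i)|j _]; last by rewrite subr_ge0.
  by rewrite mem_index_enum => /(_ isT) /eqP /eqP; rewrite subr_eq0 => /eqP.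
have gii i : g i i = 0 by have [|] := key i _; rewrite ?cE.
move=> i; split=> //.
have lt1 : c 0 i < 1 by rewrite cE invf_lt1 ?ltr0n // ltr1n ltnS.
have ub : 1 - c 0 i = n%:R / n.+1%:R.
  by rewrite cE -natr1; field; rewrite natr1 pnatr_eq0.
set S := [set: 'I_n.+1]%SET :\ i.
pose y := (1 - c 0 i)^-1 *: (c - c 0 i *: delta_mx 0 i).
have wy : weight S y by apply: weight_remove => //; rewrite finset.in_setT.
have Gy : bil g y y = 1 - n%:R^-1 ^+ 2.
  rewrite bil_remove // Gc gc gii ub cE -natr1; field.
  by rewrite (gt_eqF nR) ?natr1 ?nat1r pnatr_eq0.
have gle j : j != i -> 1 + n%:R^-1 <= g i j.
  move=> ji; have jS : j \in S by rewrite !inE ji.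
  have ymax d : weight S d -> bil g d d <= bil g y y.
    by move=> wd; rewrite Gy; apply: max wd; exact: cardT.
  have := weight_first_order gT wy (weight_delta jS) ymax.
  rewrite Gy /y bilZr bilDr gc -scaleNr bilZr bil_delta ub cE.
  rewrite (_ : g j i = g i j); last by rewrite -{1}gT mxE.
  have -> : (n%:R / n.+1%:R)^-1 * (1 + - n.+1%:R^-1 * g i j) =
     n%:R^-1 * (n.+1%:R - g i j) :> R.
    by rewrite -natr1; field; rewrite (gt_eqF nR) ?natr1 ?nat1r pnatr_eq0.
  rewrite mulrC ler_pdivrMr // -natr1.
  have -> : (1 - n%:R^-1 ^+ 2) * n%:R = n%:R - n%:R^-1 :> R.
    by field; rewrite gt_eqF.
  lra.
have sumg : \sum_(j | j != i) (g i j - (1 + n%:R^-1)) = 0.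
  have := gc i; rewrite bil_deltaE (bigD1 i) //= gii mulr0 add0r.
  under eq_bigr do rewrite cE.
  rewrite -mulr_sumr => e; rewrite sumrB.
  have -> : \sum_(j | j != i) g i j = n.+1%:R.
    apply: (@mulfI _ n.+1%:R^-1); first by rewrite invr_eq0 pnatr_eq0.
    by rewrite e mulVf ?pnatr_eq0.
  rewrite sumr_const (_ : #|_| = n); last first.
    by transitivity #|S|; [|exact: cardT]; apply: eq_card => j; rewrite !inE andbT.
  rewrite -[_ *+ n]mulr_natr -natr1; field; exact: lt0r_neq0.
move=> j ji; move/eqP: sumg; rewrite psumr_eq0 => [/allP/(_ j)|k ki].
  by rewrite mem_index_enum ji => /(_ isT) /eqP /eqP; rewrite subr_eq0 => /eqP.
by rewrite subr_ge0 gle.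
Qed.

(** Reduction to facets: by [(1 - 1 / n ^ 2) (1 + 1 / (n - 1)) = 1 + 1 / n], a facet value above
    [1 - 1 / n ^ 2] would descend to a value above the bound on some [m]-face. *)
Lemma skeleton_extremal m g c : (0 < m < n)%N -> g^T = g ->
  (forall i, 0 <= g i i) ->
  weight [set: 'I_n.+1]%SET c -> (forall i, bil g (delta_mx 0 i) c = 1) ->
  (forall S d, #|S| = m.+1 -> weight S d ->
     bil g d d <= (1 + n%:R^-1) / (1 + m%:R^-1)) ->
  forall i, g i i = 0 /\ forall j, j != i -> g i j = 1 + n%:R^-1.
Proof.
move=> /andP[m0 mn] gT g0 wc gc max; have n1 : (1 < n)%N by exact: leq_ltn_trans mn.
have mR : (0 < m%:R :> R) by rewrite ltr0n.
have n0 : (0 < n.-1%:R :> R) by rewrite ltr0n -ltnS prednK // ltnW.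
have um : (0 < 1 + m%:R^-1 :> R) by rewrite addr_gt0 // invr_gt0.
apply: (facet_extremal n1 gT g0 wc gc) => S d Sn wd.
have jE : (m + (n.-1 - m) = n.-1)%N by rewrite subnKC // -ltnS prednK // ltnW.
have [|S' [d' [_ S'm wd' le]]] := @face_chain R _ m (n.-1 - m) S g d m0 _ gT g0 wd.
  by rewrite jE prednK // ltnW.
have le2 := max _ _ S'm wd'; rewrite ler_pdivlMr // in le2.
have := le_trans le le2; rewrite jE -[leRHS]mulr1.
have -> : 1 + n.-1%:R^-1 = n%:R / n.-1%:R :> R.
  have -> : n%:R = n.-1%:R + 1 :> R by rewrite natr1 prednK // ltnW.
  by field; rewrite gt_eqF.
rewrite mulr1 mulrA ler_pdivrMr // => le3.
have nE : n.-1%:R = n%:R - 1 :> R by rewrite -[in RHS](prednK (ltnW n1)) -natr1 addrK.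
have nR : (0 < n%:R :> R) by rewrite ltr0n ltnW.
rewrite nE in le3; rewrite -(ler_pM2r nR); apply: le_trans le3 _.
rewrite le_eqVlt; apply/orP; left; apply/eqP; field; exact: lt0r_neq0.
Qed.

End Extremal.

(** * The Lorentz form *)

Section LorentzForm.
Context {R : realType} {n : nat}.
Implicit Types (x y z p q : 'rV[R]_n) (X Y : 'rV[R]_(1 + n)).

(** Signature [(1, n)], with the sign that makes lifts of points of the open ball have positive
    norm. *)
Definition lorentz : 'M[R]_(1 + n) := block_mx 1%:M 0 0 (- 1%:M).

Definition lift1 x : 'rV[R]_(1 + n) := row_mx 1%:M x.

Definition bform x y : R := bil lorentz (lift1 x) (lift1 y).

Lemma lorentzT : lorentz^T = lorentz.
Proof. by rewrite /lorentz tr_block_mx !trmx0 linearN /= !trmx1. Qed.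

Lemma bil_lorentzE X Y : bil lorentz X Y =
  lsubmx X 0 0 * lsubmx Y 0 0 - dotv (rsubmx X) (rsubmx Y).
Proof.
rewrite /bil -{1}(hsubmxK X) -{1}(hsubmxK Y) mul_row_block tr_row_mx.
rewrite mul_row_col !mulmx0 addr0 add0r mulmx1 mulmxN mulmx1 mulNmx.
by rewrite mxE [X in X + _]mxE big_ord1 [X in _ + X]mxE [_^T 0 0]mxE.
Qed.

Lemma bformE x y : bform x y = 1 - dotv x y.
Proof.
by rewrite /bform bil_lorentzE /lift1 !row_mxKl !row_mxKr !mxE eqxx mulr1.
Qed.

Lemma bformC x y : bform x y = bform y x.
Proof. exact/bilC/lorentzT. Qed.

Lemma dotvE x y : dotv x y = \sum_i x 0 i * y 0 i.
Proof. by rewrite /dotv mxE; apply: eq_bigr => i _; rewrite mxE. Qed.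

Lemma dotvC x y : dotv x y = dotv y x.
Proof. by rewrite !dotvE; apply: eq_bigr => i _; rewrite mulrC. Qed.

Lemma dotv_ge0 x : 0 <= dotv x x.
Proof. by rewrite dotvE sumr_ge0 // => i _; rewrite -expr2 sqr_ge0. Qed.

Lemma dotv_eq0 x : dotv x x = 0 -> x = 0.
Proof.
rewrite dotvE => /eqP; rewrite psumr_eq0 => [/allP x0|i _].
  apply/rowP => i; rewrite mxE; apply/eqP; rewrite -(sqrf_eq0 (x 0 i)) expr2.
  by have := x0 i; rewrite mem_index_enum => /(_ isT).
by rewrite -expr2 sqr_ge0.
Qed.

Lemma dotv_sub x y : dotv (x - y) (x - y) = dotv x x + dotv y y - 2 * dotv x y.
Proof.
by rewrite !dotvE mulr_sumr -big_split -sumrB /=; apply: eq_bigr => i _;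
   rewrite !mxE; ring.
Qed.

(** Polarization, as the difference of the lifts has Lorentz norm [- |x - y| ^ 2]. All positivity
    facts follow from it; on the sphere, [bform x y] is half the squared chordal distance. *)
Lemma bform_dist x y :
  2 * bform x y = bform x x + bform y y + dotv (x - y) (x - y).
Proof. by rewrite !bformE dotv_sub; ring. Qed.

Lemma HypE x : Hyp x <-> 0 < bform x x.
Proof. by rewrite bformE subr_gt0. Qed.

Lemma bdHypE x : bdHyp x <-> bform x x = 0.
Proof.
rewrite bformE /bdHyp /=; split=> [->|/eqP]; first by rewrite subrr.
by rewrite subr_eq0 => /eqP.
Qed.

Lemma cptHypE x : cptHyp x <-> 0 <= bform x x.
Proof.
rewrite le_eqVlt; split=> [[/HypE ->|/bdHypE ->]|/orP[/eqP/esym/bdHypE|/HypE]].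
- by rewrite orbT.
- by rewrite eqxx.
- by right.
- by left.
Qed.

Lemma Hyp_cpt x : Hyp x -> cptHyp x. Proof. by left. Qed.

Lemma bform_gt0 x y : Hyp x -> cptHyp y -> 0 < bform x y.
Proof.
move=> /HypE x0 /cptHypE y0; have := bform_dist x y; have := dotv_ge0 (x - y).
lra.
Qed.

Lemma bform_ge0 x y : cptHyp x -> cptHyp y -> 0 <= bform x y.
Proof.
move=> /cptHypE x0 /cptHypE y0.
have := bform_dist x y; have := dotv_ge0 (x - y); lra.
Qed.

Lemma bform_neq_gt0 x y : cptHyp x -> cptHyp y -> x != y -> 0 < bform x y.
Proof.
move=> /cptHypE x0 /cptHypE y0 xy.
have := bform_dist x y; have := dotv_ge0 (x - y).
rewrite le_eqVlt => /orP[/eqP/esym/dotv_eq0/eqP|]; last lra.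
by rewrite subr_eq0 (negbTE xy).
Qed.

(* The quadratic [t |-> |X - t Y|^2] is nonpositive at [t = 1], so its
   discriminant is nonnegative. *)
Lemma bform_reverse_CS x y : Hyp y -> bform x x * bform y y <= bform x y ^+ 2.
Proof.
move=> /HypE y0; have := bform_dist x y; have := dotv_ge0 (x - y).
have := sqr_ge0 (bform y y - bform x y); nra.
Qed.

(** The squared hyperbolic cosine of the distance, see [hdistE]: free of square roots and unchanged
    when lifts are rescaled. *)
Definition ratio x y : R := bform x y ^+ 2 / (bform x x * bform y y).

Lemma ratio_ge1 x y : Hyp x -> Hyp y -> 1 <= ratio x y.
Proof.
move=> hx hy; rewrite /ratio ler_pdivlMr ?mul1r; first exact: bform_reverse_CS.
by apply: mulr_gt0; apply/HypE.
Qed.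

End LorentzForm.

(** * Distances recovered from their squared hyperbolic cosines *)

Section Arcosh.
Context {R : realType}.
Implicit Types s t : R.

Definition arcosh_sqrt t : R := arcosh (Num.sqrt t).

Lemma arcosh_lt s t : 1 <= s -> s < t -> arcosh s < arcosh t.
Proof.
move=> s1 st; have t1 : 1 <= t by exact: le_trans (ltW st).
have s0 : 0 < s by exact: lt_le_trans s1.
have t0 : 0 < t by exact: lt_le_trans t1.
rewrite ltr_ln ?posrE; first last.
- by rewrite ltr_pwDl // sqrtr_ge0.
- by rewrite ltr_pwDl // sqrtr_ge0.
apply: ltr_leD => //; apply: ler_wsqrtr; rewrite lerD2r.
by apply: lerXn2r; rewrite ?nnegrE ltW.
Qed.

Lemma arcosh_sqrt_lt s t : 1 <= s -> s < t -> arcosh_sqrt s < arcosh_sqrt t.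
Proof.
move=> s1 st; apply: arcosh_lt; first by rewrite -sqrtr1 ler_wsqrtr.
by rewrite ltr_sqrt // (lt_trans _ st) // (lt_le_trans _ s1).
Qed.

Lemma arcosh_sqrt_le s t : 1 <= s -> 1 <= t ->
  (arcosh_sqrt s <= arcosh_sqrt t) = (s <= t).
Proof.
move=> s1 t1; case: (leP s t) => [|ts].
  by rewrite le_eqVlt => /orP[/eqP ->|/(arcosh_sqrt_lt s1)/ltW ->//]; rewrite lexx.
by apply/negbTE; rewrite -ltNge; exact: arcosh_sqrt_lt.
Qed.

Lemma arcosh_sqrt1 : arcosh_sqrt 1 = 0 :> R.
Proof. by rewrite /arcosh_sqrt sqrtr1 /arcosh expr1n subrr sqrtr0 addr0 ln1. Qed.

Lemma arcosh_sqrt_continuous t : 1 <= t -> {for t, continuous arcosh_sqrt}.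
Proof.
move=> t1; rewrite /arcosh_sqrt /arcosh.
have s1 : 1 <= Num.sqrt t by rewrite -sqrtr1 ler_wsqrtr.
apply: (@continuous_comp _ _ _
  (fun t => Num.sqrt t + Num.sqrt (Num.sqrt t ^+ 2 - 1)) (@ln R)); last first.
  by apply: continuous_ln; rewrite ltr_pwDl ?sqrtr_ge0 // (lt_le_trans _ s1).
apply: cvgD; first exact: sqrt_continuous.
apply: (@continuous_comp _ _ _ (fun t : R => Num.sqrt t ^+ 2 - 1)); last first.
  exact: sqrt_continuous.
apply: cvgB; last exact: cvg_cst.
by rewrite expr2; apply: cvgM; exact: sqrt_continuous.
Qed.

Lemma hdistE (n : nat) (x y : 'rV[R]_n) : Hyp x -> Hyp y ->
  hdist x y = arcosh_sqrt (ratio x y).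
Proof.
move=> hx hy; rewrite /hdist /arcosh_sqrt /ratio -!bformE; congr arcosh.
have /HypE x0 := hx; have /HypE y0 := hy.
rewrite -sqrtrM ?(ltW x0) // [in RHS]sqrtrM ?sqr_ge0 // sqrtr_sqr.
by rewrite gtr0_norm ?bform_gt0 //; [rewrite sqrtrV // mulr_ge0 // ltW|left].
Qed.

Lemma cosh_sinh x : cosh x ^+ 2 - sinh x ^+ 2 = 1 :> R.
Proof.
have := expR_gt0 x => e0; rewrite /cosh /sinh expRN; field; exact: lt0r_neq0.
Qed.

Lemma tanh_arcosh_sqrt t : 1 <= t -> tanh (arcosh_sqrt t) ^+ 2 = 1 - t^-1.
Proof.
move=> t1; have s1 : 1 <= Num.sqrt t by rewrite -sqrtr1 ler_wsqrtr.
have t0 : 0 < t by exact: lt_le_trans t1.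
have [_ ch] := arcoshK s1; have := cosh_sinh (arcosh_sqrt t).
rewrite /tanh /arcosh_sqrt ch sqr_sqrtr ?(ltW t0) // => e.
rewrite expr_div_n sqr_sqrtr ?(ltW t0) //.
have -> : sinh (arcosh (Num.sqrt t)) ^+ 2 = t - 1 by lra.
by field; exact: lt0r_neq0.
Qed.

End Arcosh.

(** * Simplices in barycentric coordinates *)

Section Barycentric.
Context {R : realType} {n : nat}.
Implicit Types (v : 'I_n.+1 -> 'rV[R]_n) (p q x y : 'rV[R]_n).
Implicit Types (S I : {set 'I_n.+1}) (c d : 'rV[R]_n.+1).

Definition bary v c : 'rV[R]_n := \sum_i c 0 i *: v i.

Lemma faceE v I x : face v I x <-> exists2 c, weight I c & x = bary v c.
Proof.
split=> [[c [c0 c1 ->]]|[c [c0 c1 cI] ->]].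
  (* In [face], coefficients outside [I] are arbitrary nonnegative numbers; they are reset to 0. *)
  exists (\row_i (if i \in I then c i else 0)).
    split=> [i||i /negbTE iI].
    - by rewrite mxE; case: ifP.
    - by under eq_bigr do rewrite mxE; rewrite -big_mkcond.
    - by rewrite mxE iI.
  rewrite /bary big_mkcond; apply: eq_bigr => i _; rewrite mxE.
  by case: ifP; rewrite ?scale0r.
have supp (V : nmodType) (F : 'I_n.+1 -> V) : (forall i, i \notin I -> F i = 0) ->
    \sum_(i in I) F i = \sum_i F i.
  by move=> F0; rewrite [RHS](bigID (mem I)) /= [X in _ + X]big1 ?addr0.
exists (fun i => c 0 i); split=> //; first by rewrite supp.
by rewrite supp // => i iI; rewrite cI // scale0r.
Qed.

Lemma skeletonE m v x : skeleton m v x <->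
  exists S c, [/\ #|S| = m.+1, weight S c & x = bary v c].
Proof.
split=> [[S Sm /faceE[c wc xE]]|[S [c [Sm wc xE]]]]; first by exists S, c.
by exists S => //; apply/faceE; exists c.
Qed.

Lemma skeleton_top v x : skeleton n v x <->
  exists2 c, weight [set: 'I_n.+1]%SET c & x = bary v c.
Proof.
split=> [/skeletonE[S [c [_ wc xE]]]|[c wc xE]].
  by exists c => //; apply: weight_sub wc; exact: finset.subsetT.
by apply/skeletonE; exists [set: 'I_n.+1]%SET, c; split; rewrite // cardsT card_ord.
Qed.

Lemma lift1_bary v c : \sum_i c 0 i = 1 ->
  lift1 (bary v c) = \sum_i c 0 i *: lift1 (v i).
Proof.
move=> c1; rewrite -[RHS]hsubmxK !linear_sum /= /lift1; congr row_mx.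
  under eq_bigr do rewrite linearZ /= row_mxKl.
  by rewrite -scaler_suml c1 scale1r.
by apply: eq_bigr => i _; rewrite linearZ /= row_mxKr.
Qed.

Lemma bform_baryl v c y : \sum_i c 0 i = 1 ->
  bform (bary v c) y = \sum_i c 0 i * bform (v i) y.
Proof.
move=> c1; rewrite /bform lift1_bary // bil_suml.
by apply: eq_bigr => i _; rewrite bilZl.
Qed.

Lemma bform_baryr v c y : \sum_i c 0 i = 1 ->
  bform y (bary v c) = \sum_i c 0 i * bform y (v i).
Proof.
by move=> c1; rewrite bformC bform_baryl //; apply: eq_bigr => i _; rewrite bformC.
Qed.

Lemma bary_cpt v S c : simplex v -> weight S c -> cptHyp (bary v c).
Proof.
move=> sv [c0 c1 _]; apply/cptHypE; rewrite bform_baryl // sumr_ge0 // => i _.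
rewrite bform_baryr // mulr_ge0 // sumr_ge0 // => j _.
by rewrite mulr_ge0 // bform_ge0.
Qed.

(* Gram matrix of the simplex seen from [p]: the entries are [1 - <w_i, w_j>]
   for the images [w_i] of the vertices under an isometry taking [p] to the
   origin of the ball. *)
Definition view p v : 'M[R]_n.+1 :=
  \matrix_(i, j) (bform p p * bform (v i) (v j) / (bform p (v i) * bform p (v j))).

Lemma view_sym p v : (view p v)^T = view p v.
Proof.
by apply/matrixP => i j; rewrite !mxE (bformC (v i)) (mulrC (bform p (v i))). Qed.

Lemma view_diag p v i : Hyp p -> simplex v -> 0 <= view p v i i.
Proof.
move=> hp sv; have /HypE p0 := hp; have /cptHypE vi := sv i.
have /ltW b0 : 0 < bform p (v i) by exact: bform_gt0.
by rewrite mxE divr_ge0 // mulr_ge0 // ltW.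
Qed.

Lemma view_point p v S d : Hyp p -> simplex v -> weight S d ->
  exists2 c, weight S c & exists s, [/\ 0 < s, bform p (bary v c) = s &
    bform p p * bform (bary v c) (bary v c) = s ^+ 2 * bil (view p v) d d].
Proof.
move=> hp sv [d0 d1 dS]; have b0 i : 0 < bform p (v i) by exact: bform_gt0.
pose e i := d 0 i / bform p (v i).
have e0 i : 0 <= e i by rewrite /e divr_ge0 // ltW.
have t0 : 0 < \sum_i e i.
  rewrite lt0r sumr_ge0 // andbT; apply/negP => /eqP e00.
  have : \sum_i d 0 i = 0.
    apply: big1 => i _; move/eqP: e00; rewrite psumr_eq0 // => /allP/(_ i).
    rewrite mem_index_enum => /(_ isT) /=.
    by rewrite mulf_eq0 invr_eq0 (gt_eqF (b0 i)) orbF => /eqP.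
  by rewrite d1 => /eqP; rewrite oner_eq0.
set t := \sum_i e i in t0.
have c1 : \sum_i (\row_j (e j / t)) 0 i = 1.
  by under eq_bigr do rewrite mxE; rewrite -mulr_suml divff ?gt_eqF.
exists (\row_i (e i / t)).
  split=> // i; first by rewrite mxE divr_ge0 // ltW.
  by move=> /dS di; rewrite mxE /e di !mul0r.
exists t^-1; split; first by rewrite invr_gt0.
  rewrite bform_baryr // -[RHS]mul1r -d1 mulr_suml; apply: eq_bigr => i _.
  by rewrite mxE /e; field; rewrite !gt_eqF.
rewrite bform_baryl // bilE !mulr_sumr; apply: eq_bigr => i _.
rewrite bform_baryr // !mulr_sumr; apply: eq_bigr => j _.
by rewrite !mxE /e; field; rewrite !gt_eqF.
Qed.

(** With [p] moved to the origin, its weights satisfy [sum_j c_j w_j = 0], so that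
    [1 - <w_i, sum_j c_j w_j> = 1]. *)
Lemma view_center v S a : simplex v -> weight S a -> Hyp (bary v a) ->
  exists2 c, weight S c &
    forall i, bil (view (bary v a) v) (delta_mx 0 i) c = 1.
Proof.
move=> sv [a0 a1 aS] hp; set p := bary v a in hp *; have /HypE p0 := hp.
have b0 i : 0 < bform p (v i) by exact: bform_gt0.
exists (\row_i (a 0 i * bform p (v i) / bform p p)); first split.
- by move=> i; rewrite mxE divr_ge0 ?mulr_ge0 // ltW.
- under eq_bigr do rewrite mxE.
  by rewrite -mulr_suml -bform_baryr // -/p divff ?gt_eqF.
- by move=> i iS; rewrite mxE aS // !mul0r.
move=> i; rewrite bil_deltaE.
transitivity (\sum_j a 0 j * bform (v i) (v j) / bform p (v i)).
  by apply: eq_bigr => j _; rewrite !mxE; field; rewrite !gt_eqF.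
by rewrite -mulr_suml -bform_baryr // -/p bformC divff ?gt_eqF.
Qed.

End Barycentric.

(** * Bounds on the distance to the skeleton, and the extremal simplices *)

Section Balanced.
Context {R : realType} {n : nat}.
Implicit Types (v : 'I_n.+1 -> 'rV[R]_n) (p q x y : 'rV[R]_n).
Implicit Types (S : {set 'I_n.+1}) (c d : 'rV[R]_n.+1).

(* The squared hyperbolic cosine of the distance from the center of a regular
   ideal [n]-simplex to its [m]-skeleton. *)
Definition extremal_ratio (n m : nat) : R := (1 + m%:R^-1) / (1 + n%:R^-1).

(** The form [view p v] is 1 at the weights of [p], so [face_chain] finds a point of an [m]-face
    with value at least [(1 + 1 / n) / (1 + 1 / m)]. This value being positive, the point lies in
    the open ball. *)
Lemma near_skeleton v p m : (0 < m < n)%N -> simplex v -> Hyp p ->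
  skeleton n v p ->
  exists q, [/\ skeleton m v q, Hyp q & ratio p q <= extremal_ratio n m].
Proof.
move=> /andP[m0 mn] sv hp /skeleton_top[a wa pE]; rewrite {p}pE in hp *.
set p := bary v a in hp *; have /HypE p0 := hp.
have [c wc gc] := view_center sv wa hp; rewrite -/p in gc.
have [c0 c1 _] := wc.
have Gc : bil (view p v) c c = 1.
  rewrite {1}(row_sum_delta c) bil_suml -c1; apply: eq_bigr => i _.
  by rewrite bilZl gc mulr1.
have [||S [d [_ Sm wd]]] :=
    @face_chain R _ m (n - m) _ (view p v) c m0 _ (view_sym p v) _ wc.
  by rewrite cardsT card_ord subnKC // ltnW.
  by move=> i; exact: view_diag.
rewrite Gc mul1r subnKC ?(ltnW mn) // => le.
have u0 : 0 < 1 + m%:R^-1 :> R by rewrite ltr_pwDl ?invr_ge0.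
have w0 : 0 < 1 + n%:R^-1 :> R by rewrite ltr_pwDl ?invr_ge0.
have G0 : 0 < bil (view p v) d d.
  by rewrite -(pmulr_lgt0 _ u0); exact: lt_le_trans le.
have [b wb [s [s0 bs bq]]] := view_point hp sv wd.
have hq : Hyp (bary v b).
  by apply/HypE; rewrite -(pmulr_rgt0 _ p0) bq mulr_gt0 // exprn_gt0.
exists (bary v b); split=> //; first by apply/skeletonE; exists S, b.
rewrite /ratio bq bs /extremal_ratio ler_pdivrMr ?mulr_gt0 ?exprn_gt0 //.
rewrite mulrAC ler_pdivlMr // mulrCA ler_pM2l ?exprn_gt0 //.
by rewrite mulrC.
Qed.

(* For vertices at infinity: up to rescaling their lifts, the Gram matrix is
   that of a regular ideal simplex. *)
Definition balanced v : Prop := exists2 u : 'I_n.+1 -> R, forall i, 0 < u i &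
  forall i j, bform (v i) (v j) = if i == j then 0 else u i * u j.

(** The lower bound on distances is an upper bound for [view p v] on all [m]-faces;
    [skeleton_extremal] then determines the whole matrix. *)
Lemma far_skeleton_balanced v p m : (0 < m < n)%N -> simplex v -> Hyp p ->
  skeleton n v p ->
  (forall q, skeleton m v q -> Hyp q -> extremal_ratio n m <= ratio p q) ->
  balanced v.
Proof.
move=> mn sv hp /skeleton_top[a wa pE] far; rewrite {p}pE in hp far.
set p := bary v a in hp far; have /HypE p0 := hp.
have [c wc gc] := view_center sv wa hp; rewrite -/p in gc.
have u0 : 0 < 1 + m%:R^-1 :> R by rewrite ltr_pwDl ?invr_ge0.
have w0 : 0 < 1 + n%:R^-1 :> R by rewrite ltr_pwDl ?invr_ge0.
have vd i : 0 <= view p v i i by exact: view_diag.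
have max S d : #|S| = m.+1 -> weight S d ->
    bil (view p v) d d <= (1 + n%:R^-1) / (1 + m%:R^-1).
  (* Without positivity the point need not lie in the open ball and [far] gives nothing, but the
     bound holds by sign. *)
  move=> Sm wd; have [G0|G0] := leP (bil (view p v) d d) 0.
    by apply: le_trans G0 _; rewrite divr_ge0 // ltW.
  have [b wb [s [s0 bs bq]]] := view_point hp sv wd.
  have hq : Hyp (bary v b).
    by apply/HypE; rewrite -(pmulr_rgt0 _ p0) bq mulr_gt0 // exprn_gt0.
  have : extremal_ratio n m <= ratio p (bary v b).
    by apply: far => //; apply/skeletonE; exists S, b.
  rewrite /ratio bq bs /extremal_ratio ler_pdivlMr ?mulr_gt0 ?exprn_gt0 //.
  rewrite mulrAC ler_pdivrMr // mulrCA ler_pM2l ?exprn_gt0 //.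
  by rewrite ler_pdivlMr // mulrC.
have gE := skeleton_extremal mn (view_sym p v) vd wc gc max.
have b0 i : 0 < bform p (v i) by exact: bform_gt0.
have k0 : 0 < (1 + n%:R^-1) / bform p p by rewrite divr_gt0.
(* These factors undo the rescaling in [view], whose off-diagonal entries all equal [1 + 1 / n]. *)
exists (fun i => Num.sqrt ((1 + n%:R^-1) / bform p p) * bform p (v i)).
  by move=> i; rewrite mulr_gt0 // sqrtr_gt0.
move=> i j; have [gii gij] := gE i; case: eqP => [<-|/eqP].
  move/eqP: gii; rewrite mxE mulf_eq0 invr_eq0 mulf_eq0 gt_eqF // mulf_eq0.
  by rewrite !(gt_eqF (b0 i)) !orbF => /eqP.
rewrite eq_sym => /gij e; rewrite mulrACA -expr2 sqr_sqrtr ?(ltW k0) // -e mxE.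
by field; rewrite !gt_eqF.
Qed.

(** The squared deviations from the mean [s / k] have a nonnegative sum. *)
Lemma sum_sqr_ge S (F : 'I_n.+1 -> R) :
  (\sum_(i in S) F i) ^+ 2 <= #|S|%:R * \sum_(i in S) F i ^+ 2.
Proof.
have [->|/finset.set0Pn[i0 i0S]] := eqVneq S finset.set0.
  by rewrite !big_set0 expr0n mulr0.
have k0 : 0 < #|S|%:R :> R by rewrite ltr0n; apply/card_gt0P; exists i0.
set k := #|S|%:R in k0 *; set s := \sum_(i in S) F i.
have : 0 <= \sum_(i in S) (F i - s / k) ^+ 2 by apply: sumr_ge0 => i _; exact: sqr_ge0.
have -> : \sum_(i in S) (F i - s / k) ^+ 2 =
    \sum_(i in S) F i ^+ 2 - 2 * (s / k) * s + k * (s / k) ^+ 2.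
  have -> : k * (s / k) ^+ 2 = \sum_(i in S) (s / k) ^+ 2.
    by rewrite sumr_const -mulr_natl.
  rewrite {3}/s mulr_sumr -sumrB -big_split /=.
  by apply: eq_bigr => i _; ring.
have -> : k * (s / k) ^+ 2 = s / k * s by field; exact: lt0r_neq0.
have -> : s ^+ 2 = k * (s / k * s) by field; exact: lt0r_neq0.
rewrite ler_pM2l //; lra.
Qed.

Lemma balanced_ideal v : balanced v -> ideal_simplex v.
Proof. by move=> [u _ ub] i; apply/bdHypE; rewrite ub eqxx. Qed.

Lemma ideal_is_simplex v : ideal_simplex v -> simplex v.
Proof. by move=> iv i; right; exact: iv. Qed.

Lemma balanced_sum v u c :
  (forall i j, bform (v i) (v j) = if i == j then 0 else u i * u j) ->
  forall i, \sum_j c 0 j * bform (v i) (v j) = u i * (\sum_j c 0 j * u j - c 0 i * u i).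
Proof.
move=> ub i; rewrite (bigD1 i) //= ub eqxx mulr0 add0r.
rewrite [\sum_j c 0 j * u j](bigD1 i) //= [X in u i * X]addrAC subrr add0r mulr_sumr.
by apply: eq_bigr => j ji; rewrite ub eq_sym (negbTE ji); ring.
Qed.

(** Pairing an affine relation with each vertex gives [c j * u j = U] for every [j], where [U] is
    the sum of these products. Summing yields [(n + 1) U = U], hence [U = 0]. *)
Lemma balanced_total v : (0 < n)%N -> balanced v -> total_simplex v.
Proof.
move=> n0 [u u0 ub] c c0 cv i.
pose d : 'rV[R]_n.+1 := \row_j c j.
have d0 j : \sum_k d 0 k * bform (v j) (v k) = 0.
  transitivity (bil lorentz (lift1 (v j)) (\sum_k c k *: lift1 (v k))).
    by rewrite bil_sumr; apply: eq_bigr => k _; rewrite bilZr mxE.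
  rewrite (_ : \sum_k _ = 0); last first.
    rewrite -[LHS]hsubmxK !linear_sum /= -[RHS]hsubmxK !linear0; congr row_mx.
      under eq_bigr do rewrite linearZ /= row_mxKl.
      by rewrite -scaler_suml c0 scale0r.
    by under eq_bigr do rewrite linearZ /= row_mxKr.
  by rewrite -(scale0r (0 : 'rV_(1 + n))) bilZr mul0r.
have cu j : c j * u j = \sum_k c k * u k.
  have := d0 j; rewrite (balanced_sum d ub) => /eqP.
  rewrite mulf_eq0 gt_eqF //= subr_eq0 => /eqP.
  by under eq_bigr do rewrite mxE; rewrite mxE => ->.
have : \sum_k c k * u k = 0.
  have e : \sum_k c k * u k = \sum_(k < n.+1) (\sum_k c k * u k).
    by apply: eq_bigr => k _; rewrite cu.
  move: e; rewrite sumr_const card_ord mulrS => /eqP.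
  rewrite eq_sym -subr_eq0 addrAC subrr add0r -mulr_natr mulf_eq0 pnatr_eq0.
  by rewrite (gtn_eqF n0) orbF => /eqP.
by rewrite -(cu i) => /eqP; rewrite mulf_eq0 (gt_eqF (u0 i)) orbF => /eqP.
Qed.

(** Weights proportional to [1 / u i]: the lifts rescaled to have pairwise products 1 then
    contribute equally. *)
Definition centroid_weight (u : 'I_n.+1 -> R) : 'rV[R]_n.+1 :=
  \row_i ((u i)^-1 / \sum_j (u j)^-1).

Lemma sum_inv_gt0 (u : 'I_n.+1 -> R) : (forall i, 0 < u i) -> 0 < \sum_j (u j)^-1.
Proof.
move=> u0; rewrite (bigD1 ord0) //= ltr_pwDl ?invr_gt0 // sumr_ge0 // => i _.
by rewrite invr_ge0 ltW.
Qed.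

Lemma centroid_weightP u : (forall i, 0 < u i) ->
  weight [set: 'I_n.+1]%SET (centroid_weight u).
Proof.
move=> u0; have s0 := sum_inv_gt0 u0; split=> [i||i].
- by rewrite mxE divr_ge0 ?invr_ge0 // ltW.
- by under eq_bigr do rewrite mxE; rewrite -mulr_suml divff ?gt_eqF.
- by rewrite finset.in_setT.
Qed.

Lemma balanced_centroid v u (s := \sum_j (u j)^-1) (p := bary v (centroid_weight u)) :
  (forall i, 0 < u i) ->
  (forall i j, bform (v i) (v j) = if i == j then 0 else u i * u j) ->
  (forall i, bform p (v i) = n%:R / s * u i) /\
  bform p p = n%:R * n.+1%:R / s ^+ 2.
Proof.
move=> u0 ub; have s0 : 0 < s by exact: sum_inv_gt0.
have [_ a1 _] := centroid_weightP u0.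
have pv i : bform p (v i) = n%:R / s * u i.
  rewrite bformC bform_baryr // (balanced_sum _ ub).
  have e j : centroid_weight u 0 j * u j = s^-1.
    by rewrite mxE mulrAC mulVf ?mul1r ?gt_eqF.
  rewrite e; under eq_bigr do rewrite e.
  rewrite sumr_const card_ord mulrS [X in _ * X]addrAC subrr add0r.
  by rewrite -[_ *+ n]mulr_natr; ring.
split=> //; rewrite {2}/p bform_baryr //.
transitivity (\sum_(i < n.+1) n%:R / s ^+ 2).
  by apply: eq_bigr => i _; rewrite pv mxE -/s; field; rewrite !gt_eqF.
by rewrite sumr_const card_ord -mulr_natr; ring.
Qed.

(** With [x_i = c_i u_i], [U] their sum and [T] the sum of their squares, the ratio from the
    centroid is [n / (n + 1) * U ^ 2 / (U ^ 2 - T)]. Cauchy-Schwarz on the [m + 1] supported indices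
    gives [U ^ 2 <= (m + 1) T]. *)
Lemma balanced_center v : (0 < n)%N -> balanced v ->
  exists p, [/\ skeleton n v p, Hyp p & forall m q, (0 < m)%N ->
    skeleton m v q -> Hyp q -> extremal_ratio n m <= ratio p q].
Proof.
move=> n0 [u u0 ub]; have nR : 0 < n%:R :> R by rewrite ltr0n.
have s0 := sum_inv_gt0 u0; have [pv pp] := balanced_centroid u0 ub.
have wa := centroid_weightP u0.
set s := \sum_j _ in s0 pv pp; set p := bary v _ in pv pp.
exists p; split; first by apply/skeleton_top; exists (centroid_weight u).
  by apply/HypE; rewrite pp divr_gt0 ?mulr_gt0 ?exprn_gt0 // ltr0n.
move=> m q m0 /skeletonE[S [c [Sm wc ->]]] /HypE hq.
have mR : 0 < m%:R :> R by rewrite ltr0n.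
have [c0 c1 cS] := wc.
pose U := \sum_i c 0 i * u i.
have pq : bform p (bary v c) = n%:R / s * U.
  rewrite bform_baryr // mulr_sumr; apply: eq_bigr => i _; rewrite pv; ring.
have qq : bform (bary v c) (bary v c) = U ^+ 2 - \sum_(i in S) (c 0 i * u i) ^+ 2.
  have -> : \sum_(i in S) (c 0 i * u i) ^+ 2 = \sum_i (c 0 i * u i) ^+ 2.
    rewrite [RHS](bigID (mem S)) /= [X in _ + X]big1 ?addr0 // => i /cS ->.
    by rewrite mul0r expr0n.
  rewrite bform_baryl // expr2 {1}/U mulr_suml -sumrB; apply: eq_bigr => i _.
  by rewrite bform_baryr // (balanced_sum c ub) -/U; ring.
have US : U = \sum_(i in S) c 0 i * u i.
  rewrite /U [LHS](bigID (mem S)) /= [X in _ + X]big1 ?addr0 // => i /cS ->.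
  by rewrite mul0r.
have := sum_sqr_ge S (fun i => c 0 i * u i); rewrite -US Sm.
rewrite /ratio /extremal_ratio pq pp; rewrite qq in hq *.
set T := \sum_(i in S) _ in hq * => le.
rewrite ler_pdivlMr; last by rewrite mulr_gt0 // divr_gt0 ?mulr_gt0 ?exprn_gt0.
have -> : (1 + m%:R^-1) / (1 + n%:R^-1) * (n%:R * n.+1%:R / s ^+ 2 * (U ^+ 2 - T)) =
   (n%:R / s) ^+ 2 * ((1 + m%:R^-1) * (U ^+ 2 - T)).
  rewrite -natr1; field; rewrite !gt_eqF //; lra.
rewrite [leRHS]exprMn ler_pM2l ?exprn_gt0 ?divr_gt0 //.
have -> : 1 + m%:R^-1 = m.+1%:R / m%:R :> R.
  by rewrite -natr1; field; rewrite gt_eqF.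
rewrite mulrAC ler_pdivrMr // -natr1; rewrite -natr1 in le; lra.
Qed.

End Balanced.

(** * Isometries *)

Section Continuity.
Context {R : realType} {n : nat}.

Lemma cvg_bform (T : Type) (F : set_system T) {FF : Filter F}
    (f h : T -> 'rV[R]_n) a b :
  f x @[x --> F] --> a -> h x @[x --> F] --> b ->
  bform (f x) (h x) @[x --> F] --> bform a b.
Proof.
move=> fa hb; rewrite bformE dotvE.
under eq_fun do rewrite bformE dotvE.
apply: cvgB; first exact: cvg_cst.
apply: cvg_sumr => i _; apply: cvgM.
  exact: (cvg_comp _ _ fa (coord_continuous (i := 0) (j := i) (x := a))).
exact: (cvg_comp _ _ hb (coord_continuous (i := 0) (j := i) (x := b))).
Qed.

Lemma continuous_rV (T : topologicalType) (f : T -> 'rV[R]_n) x :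
  (forall j, {for x, continuous (fun y => f y 0 j)}) -> {for x, continuous f}.
Proof.
move=> fc A [P Px PA].
have nP : \forall y \near x, forall j, P 0 j (f y 0 j).
  by apply: filter_forall => j; exact: (fc j _ (Px 0 j)).
by apply: filterS nP => y Py; apply: PA => i j; rewrite ord1.
Qed.

End Continuity.

Section Isometries.
Context {R : realType} {n : nat}.
Implicit Types (x y z w : 'rV[R]_n) (g : 'rV[R]_n -> 'rV[R]_n).

Lemma isometry_ratio g x y : hyp_isometry g -> Hyp x -> Hyp y ->
  bform (g x) (g y) ^+ 2 * (bform x x * bform y y) =
  bform x y ^+ 2 * (bform (g x) (g x) * bform (g y) (g y)).
Proof.
move=> [[gH _ _] gd _] hx hy; have gx := gH _ hx; have gy := gH _ hy.
have /HypE bx := hx; have /HypE by_ := hy.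
have /HypE bgx := gx; have /HypE bgy := gy.
have := gd x y; rewrite !inE => /(_ hx hy); rewrite !hdistE // => e.
have : ratio (g x) (g y) = ratio x y.
  by apply/eqP; rewrite eq_le; apply/andP; split;
    rewrite -arcosh_sqrt_le ?ratio_ge1 // e lexx.
have d1 : bform x x * bform y y != 0 by rewrite gt_eqF // mulr_gt0.
have d2 : bform (g x) (g x) * bform (g y) (g y) != 0 by rewrite gt_eqF // mulr_gt0.
by rewrite /ratio => /eqP; rewrite eqr_div // => /eqP.
Qed.

(** For points at infinity, invariance of the squared cross-ratio of chordal distances, with
    denominators cleared so that coinciding points are allowed. *)
Definition preserves_cross_ratio g x y z w : Prop :=
  bform (g x) (g y) * bform (g z) (g w) * (bform x z * bform y w) =
  bform x y * bform z w * (bform (g x) (g z) * bform (g y) (g w)).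

(** Each squared product changes by a factor attached to each of its two points; these factors
    cancel in the cross-ratio, and positivity allows taking square roots. *)
Lemma isometry_cross_Hyp g x y z w : hyp_isometry g ->
  Hyp x -> Hyp y -> Hyp z -> Hyp w -> preserves_cross_ratio g x y z w.
Proof.
move=> ig hx hy hz hw; have [[gH _ _] _ _] := ig.
have pos a b : Hyp a -> Hyp b -> 0 < bform a b.
  by move=> ha hb; apply: bform_gt0 => //; left.
have pos' a b : Hyp a -> Hyp b -> 0 < bform (g a) (g b).
  by move=> ha hb; apply: pos; exact: gH.
have sq a b : Hyp a -> Hyp b -> bform (g a) (g b) ^+ 2 =
    bform a b ^+ 2 * (bform (g a) (g a) / bform a a) * (bform (g b) (g b) / bform b b).
  move=> ha hb; have e := isometry_ratio ig ha hb.
  have d0 : bform a a * bform b b != 0 by rewrite gt_eqF // mulr_gt0 // pos.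
  apply: (mulIf d0); rewrite e; field.
  by rewrite !gt_eqF ?pos.
apply/eqP; rewrite /preserves_cross_ratio -(@eqrXn2 _ 2) //.
- rewrite !exprMn !sq //; apply/eqP; ring.
- by do !apply: mulr_ge0; apply: ltW; (exact: pos || exact: pos').
- by do !apply: mulr_ge0; apply: ltW; (exact: pos || exact: pos').
Qed.

Lemma Hyp_scale x (t : R) : cptHyp x -> 0 <= t < 1 -> Hyp (t *: x).
Proof.
move=> /cptHypE; rewrite bformE subr_ge0 => x1 /andP[t0 t1].
rewrite /Hyp /= (_ : dotv _ _ = t * (t * dotv x x)); last first.
  by rewrite !dotvE !mulr_sumr; apply: eq_bigr => i _; rewrite !mxE; ring.
have tx : t * dotv x x <= t by nra.
have : t * (t * dotv x x) <= t * t by rewrite ler_wpM2l.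
nra.
Qed.

Lemma isometry_radial g x : hyp_isometry g -> cptHyp x ->
  g (t *: x) @[t --> (1 : R)^'-] --> g x.
Proof.
move=> [_ _ gc] cx; have /subspace_continuousP/(_ x cx) gx := gc.
move=> A /gx wA.
have tx : t *: x @[t --> (1 : R)^'-] --> x.
  rewrite -{2}(scale1r x); apply: cvgZr_tmp; exact: cvg_at_left_filter.
have nA : \forall t \near (1 : R)^'-, cptHyp (t *: x) -> A (g (t *: x)) := tx _ wA.
change (\forall t \near (1 : R)^'-, A (g (t *: x))); near=> t.
apply: (near nA t) => //; left; apply: Hyp_scale => //.
by apply/andP; split; near: t; [exact: nbhs_left_ge|exact: nbhs_left_lt].
Unshelve. all: by end_near. Qed.

(** Boundary points are reached radially: the identity holds at [t x], [t y], [t z], [t w] for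
    [t < 1], and continuity of [g] on the closed ball passes it to the limit. *)
Lemma isometry_cross g x y z w : hyp_isometry g ->
  cptHyp x -> cptHyp y -> cptHyp z -> cptHyp w -> preserves_cross_ratio g x y z w.
Proof.
move=> ig hx hy hz hw.
have id_radial a : t *: a @[t --> (1 : R)^'-] --> (a : 'rV[R]_n).
  rewrite -{2}(scale1r a); apply: cvgZr_tmp; exact: cvg_at_left_filter.
pose f1 t := bform (g (t *: x)) (g (t *: y)) * bform (g (t *: z)) (g (t *: w)) *
  (bform (t *: x) (t *: z) * bform (t *: y) (t *: w)).
pose f2 t := bform (t *: x) (t *: y) * bform (t *: z) (t *: w) *
  (bform (g (t *: x)) (g (t *: z)) * bform (g (t *: y)) (g (t *: w))).
have lim1 : f1 t @[t --> (1 : R)^'-] --> f1 1.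
  rewrite /f1 !scale1r; apply: cvgM; apply: cvgM; apply: cvg_bform;
    (exact: isometry_radial || exact: id_radial).
have lim2 : f2 t @[t --> (1 : R)^'-] --> f2 1.
  rewrite /f2 !scale1r; apply: cvgM; apply: cvgM; apply: cvg_bform;
    (exact: isometry_radial || exact: id_radial).
have f12 : \forall t \near (1 : R)^'-, f2 t = f1 t.
  near=> t.
  have t01 : 0 <= t < 1.
    by apply/andP; split; near: t; [exact: nbhs_left_ge|exact: nbhs_left_lt].
  by apply/esym/(isometry_cross_Hyp ig); exact: Hyp_scale.
have : f1 1 = f2 1.
  apply: (cvg_unique (@Rhausdorff R) lim1).
  exact: cvg_trans (near_eq_cvg f12) lim2.
by rewrite /preserves_cross_ratio /f1 /f2 !scale1r.
Unshelve. all: by end_near. Qed.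

End Isometries.

(** * Regular ideal simplices are balanced *)

Section RegularBalanced.
Context {R : realType} {n : nat}.
Implicit Types (v : 'I_n.+1 -> 'rV[R]_n).

Lemma total_inj v i j : total_simplex v -> i != j -> v i != v j.
Proof.
move=> tv ij; apply/eqP => e.
have := tv (fun k => (k == i)%:R - (k == j)%:R).
have delta (V : lmodType R) (F : 'I_n.+1 -> V) k :
    \sum_l (l == k)%:R *: F l = F k.
  rewrite (bigD1 k) //= eqxx scale1r big1 ?addr0 // => l /negbTE ->.
  by rewrite scale0r.
have -> : \sum_k ((k == i)%:R - (k == j)%:R) = 0 :> R.
  rewrite sumrB; apply/eqP; rewrite subr_eq0; apply/eqP.
  (* [R^o] is [R] as a module over itself, which lets [delta] evaluate sums of scalars. *)
  transitivity (1 : R^o).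
    rewrite -[RHS](delta _ (fun=> 1) i); apply: eq_bigr => k _.
    by rewrite /GRing.scale /= mulr1.
  rewrite -[LHS](delta _ (fun=> 1) j); apply: eq_bigr => k _.
  by rewrite /GRing.scale /= mulr1.
move=> /(_ erefl); under eq_bigr do rewrite scalerBl.
rewrite sumrB !delta e subrr => /(_ erefl i) /eqP.
by rewrite eqxx (negbTE ij) subr0 oner_eq0.
Qed.

(** The isometry exchanging vertices [j] and [k] inverts this cross-ratio, whose square is therefore
    1. *)
Lemma regular_cross v i j k l :
  ideal_simplex v -> total_simplex v -> regular_simplex v ->
  i != j -> i != k -> i != l -> j != k -> j != l -> k != l ->
  bform (v i) (v j) * bform (v k) (v l) = bform (v i) (v k) * bform (v j) (v l).
Proof.
move=> iv tv rv ij ik il jk jl kl.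
have cv a : cptHyp (v a) by right; exact: iv.
have [g ig gv] := rv (tperm j k).
have := isometry_cross ig (cv i) (cv j) (cv k) (cv l).
rewrite /preserves_cross_ratio !gv tpermL tpermR (tpermD jl kl)
  tpermD 1?eq_sym // => /esym/eqP.
rewrite -!expr2 eqrXn2 ?mulr_ge0 ?bform_ge0 // => /eqP.
by [].
Qed.

Lemma regular_balanced v : (1 < n)%N ->
  total_simplex v -> ideal_simplex v -> regular_simplex v -> balanced v.
Proof.
move=> n1 tv iv rv; pose b i j := bform (v i) (v j).
have bC i j : b i j = b j i by exact: bformC.
have b0 i j : i != j -> 0 < b i j.
  move=> ij; apply: bform_neq_gt0; last exact: total_inj.
    by right; exact: iv.
  by right; exact: iv.
have cr i j k l := @regular_cross v i j k l iv tv rv.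
pose o : 'I_n.+1 := ord0; pose e1 : 'I_n.+1 := inord 1; pose e2 : 'I_n.+1 := inord 2.
have e1E : e1 = 1%N :> nat by rewrite inordK // ltnS ltnW.
have e2E : e2 = 2%N :> nat by rewrite inordK.
have o1 : o != e1 by rewrite -val_eqE /= e1E.
have o2 : o != e2 by rewrite -val_eqE /= e2E.
have e12 : e1 != e2 by rewrite -val_eqE /= e1E e2E.
(* Cross-ratios equal to 1 make [f] constant on pairs of distinct indices other than [o]. If the
   constant is [w ^ 2], the scales are [w] at [o] and [b o i / w] elsewhere. *)
pose f i j := b o i * b o j / b i j.
have fC i j : f i j = f j i by rewrite /f (bC i j) (mulrC (b o i)).
have fS i j k : o != i -> o != j -> o != k -> i != j -> i != k -> f i j = f i k.
  move=> oi oj ok ij ik; have [->//|jk] := eqVneq j k.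
  have bij : b i j != 0 by rewrite gt_eqF ?b0.
  have bik : b i k != 0 by rewrite gt_eqF ?b0.
  rewrite /f; apply/eqP; rewrite eqr_div //; apply/eqP.
  have := cr o j k i oj ok oi jk; rewrite eq_sym ij eq_sym ik => /(_ isT isT).
  rewrite -/(b o j) -/(b k i) -/(b o k) -/(b j i) (bC k i) (bC j i) => e.
  by rewrite -!mulrA; congr (_ * _); rewrite e.
have fE i j : o != i -> o != j -> i != j -> f i j = f e1 e2.
  move=> oi oj ij; have [ie|ie] := eqVneq i e1.
    by subst i; apply: fS.
  by rewrite (fS i j e1) // fC; apply: fS => //; rewrite eq_sym.
have f0 : 0 < f e1 e2 by rewrite /f divr_gt0 ?mulr_gt0 ?b0.
pose w := Num.sqrt (f e1 e2).
have w0 : 0 < w by rewrite sqrtr_gt0.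
have ww : w * w = f e1 e2 by rewrite -expr2 sqr_sqrtr // ltW.
exists (fun i => if i == o then w else b o i / w).
  move=> i; case: eqP => // /eqP io; rewrite divr_gt0 // b0 //.
  by rewrite eq_sym.
move=> i j; case: eqP => [->|/eqP ij]; first exact/bdHypE/iv.
rewrite -/(b i j); case: eqP => [io|/eqP io]; case: eqP => [jo|/eqP jo].
- by rewrite io jo eqxx in ij.
- by rewrite io; field; exact: lt0r_neq0.
- by rewrite jo bC; field; exact: lt0r_neq0.
rewrite mulf_div ww -(fE i j) //; try by rewrite eq_sym.
rewrite /f; field; rewrite !gt_eqF // b0 // eq_sym //.
Qed.

End RegularBalanced.

(** * Permutations of a balanced simplex come from Lorentz transformations *)

Section BalancedRegular.
Context {R : realType} {n : nat}.
Context (v : 'I_n.+1 -> 'rV[R]_n) (u : 'I_n.+1 -> R) (n0 : (0 < n)%N).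
Context (u0 : forall i, 0 < u i).
Context (ub : forall i j, bform (v i) (v j) = if i == j then 0 else u i * u j).
Implicit Types (s t : 'S_(1 + n)) (x y : 'rV[R]_n).

Let V : 'M[R]_(1 + n) := \matrix_(i < 1 + n) ((u i)^-1 *: lift1 (v i)).
Let G : 'M[R]_(1 + n) := \matrix_(i, j) (i != j)%:R.

Let VG : V *m lorentz *m V^T = G.
Proof.
apply/matrixP => i j; transitivity (bil lorentz (row i V) (row j V)).
  rewrite /bil -row_mul mxE [RHS]mxE; apply: eq_bigr => k _.
  congr (_ * _); first by rewrite [RHS]mxE.
  by rewrite [LHS]mxE [RHS]mxE [RHS]mxE.
rewrite !rowK bilZl bilZr -/(bform (v i) (v j)) ub [RHS]mxE.
case: eqP => _ /=; first by rewrite !mulr0.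
by field; rewrite !gt_eqF.
Qed.

Let V_unit : V \in unitmx.
Proof.
have nR : n%:R != 0 :> R by rewrite pnatr_eq0 -lt0n.
(* With [J] the all-ones matrix, [J - 1] has inverse [J / n - 1]. *)
have GK : G *m (const_mx n%:R^-1 - 1%:M) = 1%:M.
  apply/matrixP => i j; rewrite !mxE.
  transitivity (\sum_(k < 1 + n) ((i != k)%:R * n%:R^-1 - (k == j)%:R * (i != k)%:R) : R).
    by apply: eq_bigr => k _; rewrite !mxE mulrBr [X in _ - X]mulrC.
  rewrite sumrB -mulr_suml.
  have -> : \sum_(k < 1 + n) (i != k)%:R = n%:R :> R.
    rewrite (bigD1 i) //= eqxx add0r (eq_bigr (fun=> 1)) => [|k]; last first.
      by rewrite eq_sym => ->.
    rewrite sumr_const; congr _%:R.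
    have := cardC1 i; rewrite card_ord => e; rewrite -[RHS]e.
    by apply: eq_card => k; rewrite !inE.
  rewrite mulfV // (bigD1 j) //= eqxx mul1r big1 ?addr0 => [|k /negbTE ->].
    by case: eqP => _ /=; rewrite ?subr0 ?subrr.
  by rewrite mul0r.
have : V *m (lorentz *m V^T *m (const_mx n%:R^-1 - 1%:M)) = 1%:M.
  by rewrite !mulmxA VG GK.
by move/mulmx1_unit => [].
Qed.

(** The linear map permuting the rows of [V], acting on row vectors from the right. It is a Lorentz
    transformation because permutations preserve [G]. *)
Let L s : 'M[R]_(1 + n) := invmx V *m perm_mx s *m V.

Let LM s t : L s *m L t = L (s * t)%g.
Proof.
by rewrite /L perm_mxM !mulmxA mulmxK.
Qed.

Let L1 : L 1%g = 1%:M.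
Proof. by rewrite /L perm_mx1 mulmx1 mulVmx. Qed.

Let VL s : V *m L s = perm_mx s *m V.
Proof. by rewrite /L !mulmxA mulmxV // mul1mx. Qed.

Let GP s : perm_mx s *m G *m (perm_mx s)^T = G.
Proof.
rewrite tr_perm_mx -row_permE -col_permE.
by apply/matrixP => i j; rewrite !mxE (inj_eq perm_inj).
Qed.

Let L_lorentz s X Y : bil lorentz (X *m L s) (Y *m L s) = bil lorentz X Y.
Proof.
rewrite /bil trmx_mul.
have -> : X *m L s *m lorentz *m ((L s)^T *m Y^T) =
    X *m (L s *m lorentz *m (L s)^T) *m Y^T by rewrite !mulmxA.
suff -> : L s *m lorentz *m (L s)^T = lorentz by [].
have -> : lorentz = invmx V *m G *m (invmx V)^T.
  by rewrite -VG !mulmxA mulVmx // mul1mx -mulmxA -trmx_mul mulVmx // trmx1 mulmx1.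
rewrite /L !trmx_mul.
have -> : invmx V *m perm_mx s *m V *m (invmx V *m G *m (invmx V)^T) *m
   (V^T *m ((perm_mx s)^T *m (invmx V)^T)) =
   invmx V *m (perm_mx s *m ((V *m invmx V) *m G *m ((invmx V)^T *m V^T))
     *m (perm_mx s)^T) *m (invmx V)^T.
  by rewrite !mulmxA.
by rewrite mulmxV // mul1mx -trmx_mul mulmxV // trmx1 mulmx1 GP.
Qed.

Let lift_vertex s i : lift1 (v i) *m L s = (u i / u (s i)) *: lift1 (v (s i)).
Proof.
have rV j : lift1 (v j) = u j *: row j V by rewrite rowK scalerA divff ?scale1r ?gt_eqF.
rewrite !rV -scalemxAl -row_mul VL -row_permE scalerA divfK ?gt_eqF //.
by congr (_ *: _); apply/rowP => k; rewrite !mxE.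
Qed.

(** The lift of the centroid is proportional to the sum of the rows of [V], hence fixed. It serves
    to show that [L s] does not exchange the two halves of the light cone. *)
Let center : exists2 p, Hyp p & forall s, lift1 p *m L s = lift1 p.
Proof.
have c0 := sum_inv_gt0 u0; have [_ pp] := balanced_centroid u0 ub.
have [_ a1 _] := centroid_weightP u0.
exists (bary v (centroid_weight u)).
  by apply/HypE; rewrite pp divr_gt0 ?mulr_gt0 ?exprn_gt0 // ltr0n.
move=> s; have -> : lift1 (bary v (centroid_weight u)) =
    (\sum_j (u j)^-1)^-1 *: (const_mx 1 *m V).
  rewrite lift1_bary // mulmx_sum_row scaler_sumr; apply: eq_bigr => i _.
  by rewrite !mxE rowK scale1r scalerA mulrC.
rewrite -scalemxAl -mulmxA VL mulmxA; congr (_ *: (_ *m _)).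
by rewrite -(invgK s) -col_permE; apply/rowP => k; rewrite !mxE.
Qed.

Let scale s x : R := lsubmx (lift1 x *m L s) 0 0.

(** The image [(k, y)] satisfies [|y| ^ 2 <= k ^ 2] and [<y, p> < k], where [|p| < 1]. Then [k < 0]
    contradicts [|y - k p| ^ 2 >= 0], and [k = 0] forces [y = 0]. *)
Let scale_gt0 s x : cptHyp x -> 0 < scale s x.
Proof.
move=> cx; have [p hp pL] := center.
have := bform_gt0 hp cx.
have -> : bform p x = bform x p by exact: bformC.
rewrite /bform -(L_lorentz s) pL.
have /cptHypE := cx; rewrite /bform -(L_lorentz s) !bil_lorentzE.
rewrite /lift1 row_mxKl row_mxKr -/(lift1 x) -/(scale s x) mxE eqxx mulr1.
set y := rsubmx _; set k := scale s x; move: hp; rewrite /Hyp /= => p1 yk kp.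
rewrite ltNge; apply/negP => k0.
have := dotv_ge0 (y - k *: p).
have -> : dotv (y - k *: p) (y - k *: p) =
    dotv y y - 2 * k * dotv y p + k ^+ 2 * dotv p p.
  rewrite !dotvE !mulr_sumr -sumrB -big_split /=.
  by apply: eq_bigr => i _; rewrite !mxE; ring.
have : k < 0 \/ k = 0.
  by move: k0; rewrite le_eqVlt => /orP[/eqP|]; [right|left].
case=> [kneg|k00]; first by nra.
have /dotv_eq0 y0 : dotv y y = 0.
  by apply/eqP; rewrite eq_le dotv_ge0 andbT; rewrite k00 in yk; lra.
by move: kp; rewrite k00 y0 dotvE big1 ?subrr ?ltxx // => i _; rewrite mxE mul0r.
Qed.

(** The projective action: the image of the lift is rescaled to have first coordinate 1. *)
Let act s x : 'rV[R]_n := (scale s x)^-1 *: rsubmx (lift1 x *m L s).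

Let lift_act s x : cptHyp x -> lift1 (act s x) = (scale s x)^-1 *: (lift1 x *m L s).
Proof.
move=> /(scale_gt0 s) k0; rewrite -[RHS]hsubmxK !linearZ /= /lift1; congr row_mx.
apply/matrixP => i j; rewrite !ord1 mxE eqxx [RHS]mxE -/(lift1 x) -/(scale s x).
by rewrite mulVf ?gt_eqF.
Qed.

Let bform_act s x y : cptHyp x -> cptHyp y ->
  bform (act s x) (act s y) = bform x y / (scale s x * scale s y).
Proof.
move=> cx cy; rewrite /bform !lift_act // bilZl bilZr L_lorentz.
by rewrite mulrCA mulrA mulrC invfM mulrC; ring.
Qed.

Let act_cpt s x : Hyp x -> Hyp (act s x).
Proof.
move=> hx; have cx := Hyp_cpt hx; have /HypE x0 := hx.
by apply/HypE; rewrite bform_act // divr_gt0 // mulr_gt0 ?scale_gt0.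
Qed.

Let lift1_inj : injective (@lift1 R n).
Proof. by move=> x y /eq_row_mx[]. Qed.

Let actK s x : Hyp x -> act s^-1%g (act s x) = x.
Proof.
move=> hx; have cx := Hyp_cpt hx; have ca := Hyp_cpt (act_cpt s hx).
have := lift_act s^-1%g ca; rewrite (lift_act s cx) -scalemxAl -mulmxA LM mulgV L1 mulmx1.
rewrite scalerA; set k := _ * _ => e.
have k1 : k = 1.
  have := congr1 (fun X => lsubmx X 0 0) e; rewrite linearZ /= /lift1 !row_mxKl.
  by rewrite mxE eqxx mxE mxE eqxx mulr1.
by apply: lift1_inj; rewrite e k1 scale1r.
Qed.

Let act_vertex s i : act s (v i) = v (s i).
Proof.
have cvx j : cptHyp (v j) by right; apply/bdHypE; rewrite ub eqxx.
have k0 := scale_gt0 s (cvx i).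
have kE : scale s (v i) = u i / u (s i).
  by rewrite /scale lift_vertex linearZ /= /lift1 row_mxKl mxE mxE eqxx mulr1.
apply: lift1_inj; rewrite lift_act // lift_vertex scalerA -kE mulVf ?scale1r //.
by rewrite gt_eqF.
Qed.

Let act_continuous s x : cptHyp x -> {for x, continuous (act s)}.
Proof.
move=> cx; have lin j : continuous (fun y => (lift1 y *m L s) 0 j).
  have -> : (fun y => (lift1 y *m L s) 0 j) =
      (fun y => usubmx (L s) 0 j + \sum_k y 0 k * dsubmx (L s) k j).
    apply/funext => y; rewrite -{1}(vsubmxK (L s)) /lift1 mul_row_col mul1mx.
    by rewrite mxE; congr (_ + _); rewrite mxE.
  apply: continuous_addr; first exact: cst_continuous.
  apply: continuous_sumr => k _; apply: continuous_mulr.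
    exact: coord_continuous.
  exact: cst_continuous.
have -> : act s = fun y => (scale s y)^-1 *: rsubmx (lift1 y *m L s) by [].
apply: continuous_rV => j.
have -> : (fun y => ((scale s y)^-1 *: rsubmx (lift1 y *m L s)) 0 j) =
  (fun y => ((lift1 y *m L s) 0 (lshift n 0))^-1 * (lift1 y *m L s) 0 (rshift 1 j)).
  by apply/funext => y; rewrite mxE /scale !mxE.
apply: continuousM; last exact: lin.
apply: continuousV; last exact: lin.
by have := scale_gt0 s cx; rewrite /scale mxE => /gt_eqF ->.
Qed.

Lemma balanced_isometry s : exists2 g, hyp_isometry g & forall i, g (v i) = v (s i).
Proof.
exists (act s); last exact: act_vertex; split.
- split=> [x hx|x y|y hy]; first exact: act_cpt.
    by rewrite !inE => hx hy e; rewrite -(actK s hx) e actK.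
  exists (act s^-1%g y); first exact: act_cpt.
  by rewrite -{1}(invgK s) actK.
- move=> x y; rewrite !inE => hx hy; rewrite !hdistE //; try exact: act_cpt.
  have cx := Hyp_cpt hx; have cy := Hyp_cpt hy.
  have kx := scale_gt0 s cx; have ky := scale_gt0 s cy.
  have /HypE x0 := hx; have /HypE y0 := hy.
  rewrite /ratio !bform_act //; congr arcosh_sqrt; field.
  by rewrite !gt_eqF.
- apply: continuous_in_subspaceT => x; rewrite inE; exact: act_continuous.
Qed.

End BalancedRegular.

Lemma balanced_regular (R : realType) (n : nat) (v : 'I_n.+1 -> 'rV[R]_n) :
  (0 < n)%N -> balanced v -> regular_simplex v.
Proof. move=> n0 [u u0 ub] s; exact: balanced_isometry n0 u0 ub s. Qed.

(** * Depth of simplices *)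

Section RegularSimplex.
Context {R : realType} {n : nat}.

(** A regular simplex inscribed in the unit sphere of [R^n]. The constant added to [a e_j] makes the
    coordinates sum to [1 / sqrt n], so the product with the last vertex is [- 1 / n]. *)
Definition std_simplex (i : 'I_n.+1) : 'rV[R]_n :=
  let a := Num.sqrt (1 + n%:R^-1) in
  let r := Num.sqrt n%:R in
  if unlift ord_max i is Some j
  then a *: delta_mx 0 j + const_mx ((r^-1 - a) / n%:R)
  else const_mx (- r^-1).

Lemma std_simplex_balanced : (0 < n)%N -> balanced std_simplex.
Proof.
move=> n0; have nR : 0 < n%:R :> R by rewrite ltr0n.
have k0 : 0 < 1 + n%:R^-1 :> R by rewrite ltr_pwDl ?invr_ge0.
exists (fun=> Num.sqrt (1 + n%:R^-1)) => [i|i j]; first by rewrite sqrtr_gt0.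
rewrite -expr2 sqr_sqrtr ?(ltW k0) // bformE /std_simplex.
set a := Num.sqrt (1 + _); set r := Num.sqrt n%:R; set b := _ / _.
have r0 : 0 < r by rewrite sqrtr_gt0.
have rr : r ^+ 2 = n%:R by rewrite sqr_sqrtr // ltW.
have aa : a ^+ 2 = 1 + n%:R^-1 by rewrite sqr_sqrtr // ltW.
have bE : n%:R * b = r^-1 - a by rewrite /b mulrCA divff ?mulr1 // gt_eqF.
have dcc c d : dotv (const_mx c) (const_mx d : 'rV[R]_n) = n%:R * c * d.
  rewrite dotvE; under eq_bigr do rewrite !mxE.
  by rewrite sumr_const card_ord -[LHS]mulr_natl mulrA.
have ddc k c d : dotv (a *: delta_mx 0 k + const_mx c) (const_mx d : 'rV[R]_n) =
    a * d + n%:R * c * d.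
  rewrite -dcc !dotvE; under eq_bigr do rewrite !mxE mulrDl.
  rewrite big_split /= (bigD1 k) //= eqxx mulr1 big1 ?addr0 => [|l /negbTE ->].
    by congr (_ + _); apply: eq_bigr => l _; rewrite !mxE.
  by rewrite mulr0 mul0r.
have ddd k l c d : dotv (a *: delta_mx 0 k + const_mx c)
    (a *: delta_mx 0 l + const_mx d : 'rV[R]_n) =
    a ^+ 2 * (k == l)%:R + a * c + a * d + n%:R * c * d.
  transitivity (dotv (a *: delta_mx 0 k + const_mx c) (const_mx d : 'rV[R]_n) +
    a * (a *: delta_mx 0 k + const_mx c : 'rV[R]_n) 0 l).
    rewrite !dotvE (bigD1 l) //= [X in _ = X + _](bigD1 l) //= !mxE !eqxx /= mulr1.
    rewrite [RHS]addrAC; congr (_ + _); first by ring.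
    by apply: eq_bigr => q /negbTE ql; rewrite !mxE ql andbF mulr0 add0r.
  by rewrite ddc !mxE eq_sym; ring.
have nn : n%:R * b * b = b * (r^-1 - a) by rewrite -bE; ring.
have key : 2 * (a * b) + n%:R * b * b = - n%:R^-1.
  have -> : 2 * (a * b) + n%:R * b * b = b * (r^-1 + a) by rewrite nn; ring.
  apply: (@mulfI _ n%:R); first by rewrite gt_eqF.
  rewrite mulrA bE mulrN divff ?gt_eqF //.
  have -> : (r^-1 - a) * (r^-1 + a) = (r ^+ 2)^-1 - a ^+ 2.
    by field; rewrite gt_eqF.
  by rewrite rr aa; ring.
have rrV : r^-1 * r^-1 = n%:R^-1 by rewrite -rr; field; rewrite gt_eqF.
case: unliftP => [k|] ->; case: unliftP => [l|] ->.
- rewrite ddd (inj_eq lift_inj); case: eqP => _; rewrite ?mulr1 ?mulr0 ?aa; lra.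
- rewrite ddc eq_sym (negbTE (neq_lift _ _)).
  have -> : a * - r^-1 + n%:R * b * - r^-1 = - (r^-1 * r^-1) by rewrite bE; ring.
  by rewrite rrV opprK.
- rewrite dotvC ddc (negbTE (neq_lift _ _)).
  have -> : a * - r^-1 + n%:R * b * - r^-1 = - (r^-1 * r^-1) by rewrite bE; ring.
  by rewrite rrV opprK.
- by rewrite dcc eqxx -mulrA mulrNN rrV divff ?subrr // gt_eqF.
Qed.

End RegularSimplex.

Section Delta.
Context {R : realType} {n : nat}.
Implicit Types (v : 'I_n.+1 -> 'rV[R]_n) (p : 'rV[R]_n).

Definition max_depth m : R := arcosh_sqrt (extremal_ratio n m).

Lemma extremal_ratio_ge1 m : (0 < m <= n)%N -> 1 <= extremal_ratio n m :> R.
Proof.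
move=> /andP[m0 mn]; rewrite /extremal_ratio ler_pdivlMr ?mul1r.
  by rewrite lerD2l lef_pV2 ?posrE ?ltr0n ?ler_nat // (leq_trans m0).
by rewrite ltr_pwDl ?invr_ge0.
Qed.

Lemma extremal_ratio_gt1 m : (0 < m < n)%N -> 1 < extremal_ratio n m :> R.
Proof.
move=> /andP[m0 mn]; rewrite /extremal_ratio ltr_pdivlMr ?mul1r.
  by rewrite ltrD2l ltf_pV2 ?posrE ?ltr0n ?ltr_nat // (leq_trans m0) // ltnW.
by rewrite ltr_pwDl ?invr_ge0.
Qed.

Lemma max_depth_gt0 m : (0 < m < n)%N -> 0 < max_depth m.
Proof.
move=> mn; rewrite -arcosh_sqrt1 arcosh_sqrt_lt //; exact: extremal_ratio_gt1.
Qed.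

Lemma hdist_set_le m v p : (0 < m < n)%N -> simplex v -> Hyp p -> skeleton n v p ->
  (hdist_set p (skeleton m v) <= (max_depth m)%:E)%E.
Proof.
move=> mn sv hp sp; have [q [sq hq le]] := near_skeleton mn sv hp sp.
apply: (@le_trans _ _ (hdist p q)%:E).
  by apply: ereal_inf_lbound; exists q.
have /andP[m0 /ltnW mn'] := mn.
rewrite lee_fin hdistE // arcosh_sqrt_le // ?ratio_ge1 //.
by apply: extremal_ratio_ge1; rewrite m0.
Qed.

Lemma delta_le m v : (0 < m < n)%N -> simplex v ->
  (delta m v <= (max_depth m)%:E)%E.
Proof.
move=> mn sv; apply: ge_ereal_sup => _ [->|[p [sp hp] <-]].
  by rewrite lee_fin ltW // max_depth_gt0.
exact: hdist_set_le.
Qed.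

Lemma delta_ge0 m v : (0 <= delta m v)%E.
Proof. by apply: ereal_sup_ubound; left. Qed.

Lemma balanced_delta m v : (0 < m < n)%N -> balanced v ->
  delta m v = (max_depth m)%:E.
Proof.
move=> mn bv; have sv := ideal_is_simplex (balanced_ideal bv).
have /andP[m0 mn'] := mn; have n0 : (0 < n)%N by exact: leq_ltn_trans mn'.
apply/eqP; rewrite eq_le delta_le //=.
have [p [sp hp far]] := balanced_center n0 bv.
apply: (@le_trans _ _ (hdist_set p (skeleton m v))); last first.
  by apply: ereal_sup_ubound; right; exists p.
apply: le_ereal_inf_tmp => _ [q [sq hq] <-].
rewrite lee_fin hdistE // arcosh_sqrt_le ?ratio_ge1 //; first exact: far.
by apply: extremal_ratio_ge1; rewrite m0 ltnW.
Qed.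

Lemma muE m : (0 < m < n)%N -> mu R n m = (max_depth m)%:E.
Proof.
move=> mn; have n0 : (0 < n)%N by case/andP: mn => _; exact: leq_ltn_trans.
apply/eqP; rewrite eq_le; apply/andP; split.
  by apply: ge_ereal_sup => _ [v sv <-]; exact: delta_le.
have bv := @std_simplex_balanced R n n0; rewrite -(balanced_delta mn bv).
apply: ereal_sup_ubound; exists std_simplex => //.
exact: ideal_is_simplex (balanced_ideal bv).
Qed.

(** Since [max_depth m] is positive, the attained value is the depth of a genuine point [p], and
    every point of the skeleton is at least that far from [p]. *)
Lemma delta_max_balanced m v : (0 < m < n)%N -> simplex v ->
  depths m v (delta m v) -> delta m v = (max_depth m)%:E -> balanced v.
Proof.
move=> mn sv; have /andP[m0 mn'] := mn.
move=> [->|[p [sp hp] <-]] e.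
  by move/eqP: e; rewrite eqe lt_eqF // max_depth_gt0.
apply: (far_skeleton_balanced mn sv hp sp) => q sq hq.
rewrite -arcosh_sqrt_le ?ratio_ge1 -?hdistE //; last first.
  by apply: extremal_ratio_ge1; rewrite m0 ltnW.
by rewrite -lee_fin -/(max_depth m) -e; apply: ereal_inf_lbound; exists q.
Qed.

End Delta.

(** * The depth of a simplex is attained *)

Lemma superset_card (T : finType) (A : {set T}) k :
  (#|A| <= k <= #|T|)%N -> exists2 B : {set T}, A \subset B & #|B| = k.
Proof.
elim: k => [|k IH] /andP[Ak kT].
  by exists A => //; apply/eqP; rewrite -leqn0.
move: Ak; rewrite leq_eqVlt => /orP[/eqP Ak|]; first by exists A.
rewrite ltnS => Ak; have [|B AB Bk] := IH; first by rewrite Ak ltnW.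
have : ~: B != finset.set0 by rewrite -finset.card_gt0 cardsCs finset.setCK Bk subn_gt0.
move=> /finset.set0Pn[x]; rewrite inE => xB.
exists (x |: B); first by rewrite (fintype.subset_trans AB) // finset.subsetUr.
by rewrite cardsU1 xB Bk.
Qed.

Lemma near_lt_continuous (R : realType) (T : topologicalType) (f : T -> R) x c :
  {for x, continuous f} -> f x < c -> \forall y \near x, f y < c.
Proof. by move=> fc; exact: cvgr_lt fc c. Qed.

Section Attained.
Context {R : realType} {n : nat}.
Implicit Types (v : 'I_n.+1 -> 'rV[R]_n) (a c : 'rV[R]_n.+1).

Lemma bary_continuous v : continuous (bary v).
Proof.
move=> a; apply: continuous_rV => j; move: a.
have -> : (fun a => bary v a 0 j) = (fun a => \sum_i a 0 i * v i 0 j).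
  by apply/funext => a; rewrite /bary summxE; apply: eq_bigr => i _; rewrite mxE.
apply: continuous_sumr => i _; apply: continuous_mulr.
  exact: coord_continuous.
exact: cst_continuous.
Qed.

Lemma continuous_bform (T : topologicalType) (f h : T -> 'rV[R]_n) :
  continuous f -> continuous h -> continuous (fun x => bform (f x) (h x)).
Proof. by move=> fc hc x; apply: cvg_bform; [exact: fc|exact: hc]. Qed.

Lemma ratio_continuous v q a : Hyp (bary v a) -> Hyp q ->
  {for a, continuous (fun a => ratio (bary v a) q)}.
Proof.
move=> /HypE ha /HypE hq; have bc := @bary_continuous v.
have b1 : continuous (fun a => bform (bary v a) (bary v a)) by exact: continuous_bform.
have b2 : continuous (fun a => bform (bary v a) q).
  by apply: continuous_bform => //; exact: cst_continuous.
have b3 : continuous (fun a => bform (bary v a) q ^+ 2) := continuous_mulr b2 b2.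
rewrite /ratio; apply: continuousM; first exact: b3.
apply: continuousV; first by rewrite mulf_neq0 // gt_eqF.
by apply: continuousM; [exact: b1|exact: cst_continuous].
Qed.

(* Near an ideal vertex [w] the edge from [w] to any other vertex comes close
   to every point of the simplex. *)
Lemma near_ideal_vertex m v w i0 j0 a : (0 < m <= n)%N -> simplex v ->
  bform w w = 0 -> v i0 = w -> v j0 != w -> weight [set: 'I_n.+1]%SET a ->
  Hyp (bary v a) ->
  let alpha := \sum_i a 0 i * (v i == w)%:R in
  let eta := \sum_i a 0 i * ((v i != w)%:R * bform (v i) (v j0)) in
  0 < alpha ->
  exists q, [/\ skeleton m v q, Hyp q &
    ratio (bary v a) q <= (1 + eta / (2 * alpha * bform w (v j0))) ^+ 2].
Proof.
move=> /andP[m0 mn] sv ww i0w j0w wa hp alpha eta al0.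
have [a0 a1 _] := wa; set p := bary v a in hp *.
have cw : cptHyp w by apply/cptHypE; rewrite ww.
have cp := Hyp_cpt hp.
set beta := bform w (v j0).
have b0 : 0 < beta by apply: bform_neq_gt0 => //; rewrite eq_sym.
pose s := bform p w; have s0 : 0 < s by exact: bform_gt0.
(* With this [t], the combination [alpha w + t v_j0] of lifts has the same Lorentz product with [w]
   as [p]; [x] normalizes its weights. *)
have [t tE t0] : exists2 t, t = s / beta & 0 < t by exists (s / beta); rewrite ?divr_gt0.
pose x := alpha + t; have x0 : 0 < x by rewrite addr_gt0.
pose c : 'rV[R]_n.+1 := (1 - t / x) *: delta_mx 0 i0 + (t / x) *: delta_mx 0 j0.
have wc : weight [set i0; j0]%SET c.
  apply: weight_conv; try by apply: weight_delta; rewrite !inE eqxx ?orbT.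
  by rewrite divr_ge0 ?(ltW t0) ?(ltW x0) //= ler_pdivrMr // mul1r lerDr ltW.
have [c0 c1 _] := wc.
have bq y : bform (bary v c) y = x^-1 * (alpha * bform w y + t * bform (v j0) y).
  have sum_delta k (F : 'I_n.+1 -> R) :
      \sum_i (delta_mx 0 k : 'rV[R]_n.+1) 0 i * F i = F k.
    rewrite (bigD1 k) //= mxE !eqxx mul1r big1 ?addr0 // => i /negbTE ik.
    by rewrite mxE ik mul0r.
  rewrite bform_baryl //; under eq_bigr do rewrite !mxE mulrDl -!mulrA.
  rewrite big_split /= -!mulr_sumr.
  have -> : \sum_i ((0 == 0 :> 'I_1) && (i == i0))%:R * bform (v i) y = bform w y.
    rewrite -i0w -[RHS](sum_delta i0 (fun i => bform (v i) y)).
    by apply: eq_bigr => i _; rewrite mxE.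
  have -> : \sum_i ((0 == 0 :> 'I_1) && (i == j0))%:R * bform (v i) y = bform (v j0) y.
    rewrite -[RHS](sum_delta j0 (fun i => bform (v i) y)).
    by apply: eq_bigr => i _; rewrite mxE.
  by rewrite /x; field; rewrite gt_eqF.
have sE : s = \sum_i a 0 i * ((v i != w)%:R * bform (v i) w).
  rewrite /s bform_baryl //; apply: eq_bigr => i _.
  by case: eqP => [->|_]; rewrite ?ww ?mul1r ?mul0r.
have bp y : bform p y =
    alpha * bform w y + \sum_i a 0 i * ((v i != w)%:R * bform (v i) y).
  rewrite bform_baryl // mulr_suml -big_split /=; apply: eq_bigr => i _.
  by case: eqP => [->|_] /=; ring.
have pp : 2 * alpha * s <= bform p p.
  rewrite bp -/p bformC -/s.
  have : alpha * s <= \sum_i a 0 i * ((v i != w)%:R * bform (v i) p).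
    rewrite {1}sE mulr_sumr; apply: ler_sum => i _.
    rewrite mulrCA ler_wpM2l // mulrCA ler_wpM2l // (bformC _ p) bp bformC lerDl.
    by apply: sumr_ge0 => k _; rewrite !mulr_ge0 // bform_ge0.
  lra.
have qq : x^-1 ^+ 2 * (2 * alpha * s) <= bform (bary v c) (bary v c).
  rewrite bq (bformC w) (bformC (v j0)) !bq ww (bformC (v j0) w) -/beta.
  have -> : x^-1 * (alpha * (x^-1 * (alpha * 0 + t * beta)) +
      t * (x^-1 * (alpha * beta + t * bform (v j0) (v j0)))) =
      x^-1 ^+ 2 * (2 * alpha * (t * beta) + t ^+ 2 * bform (v j0) (v j0)) by ring.
  rewrite ler_pM2l ?exprn_gt0 ?invr_gt0 // tE divfK ?gt_eqF // lerDl.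
  by rewrite mulr_ge0 ?sqr_ge0 ?bform_ge0.
have as0 : 0 < 2 * alpha * s by rewrite !mulr_gt0.
have qq0 : 0 < bform (bary v c) (bary v c).
  by apply: lt_le_trans qq; rewrite mulr_gt0 // exprn_gt0 // invr_gt0.
exists (bary v c); split; last first.
- rewrite /ratio -/beta; set e := 1 + _.
  have -> : bform p (bary v c) = x^-1 * (2 * alpha * s) * e.
    rewrite bformC bq (bformC w) -/s (bformC (v j0)) bp -/beta -/eta /e.
    by rewrite tE; field; rewrite !gt_eqF.
  rewrite ler_pdivrMr; last by rewrite mulr_gt0 //; exact/HypE.
  rewrite exprMn mulrC ler_wpM2l ?sqr_ge0 //.
  have q0 : 0 <= x^-1 ^+ 2 * (2 * alpha * s) by rewrite mulr_ge0 ?sqr_ge0 // ltW.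
  apply: le_trans (ler_pM (ltW as0) q0 pp qq).
  by rewrite le_eqVlt; apply/orP; left; apply/eqP; ring.
- exact/HypE.
have [|T sT Tm] := @superset_card _ [set i0; j0]%SET m.+1.
  by rewrite cards2 card_ord; case: (_ != _); rewrite !ltnS ?m0 ?mn // ltnW.
by apply/skeletonE; exists T, c; split=> //; exact: weight_sub wc.
Qed.

(** A point of the sphere is extreme in the closed ball: only vertices equal to it can carry
    weight. *)
Lemma vertex_at_infinity v a i : simplex v ->
  weight [set: 'I_n.+1]%SET a -> bform (bary v a) (bary v a) = 0 ->
  v i != bary v a -> a 0 i = 0.
Proof.
move=> sv wa ww vi; have [a0 a1 _] := wa; have cw := bary_cpt sv wa.
set w := bary v a in ww vi cw.
move: ww; rewrite {1}/w bform_baryl // => /eqP.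
rewrite psumr_eq0 => [/allP/(_ i)|j _]; last by rewrite mulr_ge0 // bform_ge0.
rewrite mem_index_enum => /(_ isT) /=; rewrite mulf_eq0 => /orP[/eqP //|/eqP b0].
by have := bform_neq_gt0 (sv i) cw vi; rewrite b0 ltxx.
Qed.

(** Local form of upper semicontinuity. At a point of the ball, a nearby skeleton point stays near
    by continuity; at a point of the sphere, [near_ideal_vertex] makes the depth tend to 0. *)
Lemma depth_near m v a (r : R) : (0 < m <= n)%N -> simplex v -> 0 < r ->
  weight [set: 'I_n.+1]%SET a ->
  (Hyp (bary v a) -> (hdist_set (bary v a) (skeleton m v) < r%:E)%E) ->
  exists2 e, e < r & \forall a' \near a, weight [set: 'I_n.+1]%SET a' ->
    Hyp (bary v a') -> (hdist_set (bary v a') (skeleton m v) <= e%:E)%E.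
Proof.
move=> mn sv r0 wa dr; have cw := bary_cpt sv wa; have [a0 a1 _] := wa.
have bound a' q e : skeleton m v q -> Hyp q -> Hyp (bary v a') ->
    arcosh_sqrt (ratio (bary v a') q) <= e ->
    (hdist_set (bary v a') (skeleton m v) <= e%:E)%E.
  move=> sq hq ha' le; apply: (@le_trans _ _ (hdist (bary v a') q)%:E).
    by apply: ereal_inf_lbound; exists q.
  by rewrite lee_fin hdistE.
case: (cw) => [hp|/bdHypE ww].
  have [_ [q [sq hq] <-]] := ereal_inf_lt (dr hp).
  rewrite lte_fin hdistE // => qr.
  have [e /andP[qe er]] : exists e, arcosh_sqrt (ratio (bary v a) q) < e < r.
    by exists ((arcosh_sqrt (ratio (bary v a) q) + r) / 2); rewrite !midf_lt.
  exists e => //.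
  have nr : \forall a' \near a, arcosh_sqrt (ratio (bary v a') q) < e.
    apply: near_lt_continuous => //.
    apply: (@continuous_comp _ _ _ (fun a => ratio (bary v a) q)).
      exact: ratio_continuous.
    by apply: arcosh_sqrt_continuous; exact: ratio_ge1.
  by apply: filterS nr => a' lt wa' ha'; apply: (bound _ q) => //; exact: ltW.
set w := bary v a in ww cw.
have zero i : v i != w -> a 0 i = 0 by exact: vertex_at_infinity.
have [j0w|[j0 j0w]] : (forall j, v j = w) \/ (exists j, v j != w).
  have [/existsP[j jw]|/existsPn aw] := boolP [exists j, v j != w].
    by right; exists j.
  by left => j; apply/eqP; have := aw j; rewrite negbK.
  (* All vertices coincide with the ideal point [w], so no weights give a point of the ball and the
     bound is vacuous. *)
  exists 0 => //; apply: (@filterE _ (nbhs a)) => a' [_ a1' _] /HypE.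
  rewrite bform_baryl // big1 ?ltxx // => i _.
  by rewrite bform_baryr // big1 ?mulr0 // => k _; rewrite !j0w ww mulr0.
have [i0 i0w] : exists i, v i = w.
  apply: contrapT => nw; have : \sum_i a 0 i = 0.
    by apply: big1 => i _; apply: zero; apply/eqP => iw; apply: nw; exists i.
  by rewrite a1 => /eqP; rewrite oner_eq0.
pose alpha (a : 'rV[R]_n.+1) := \sum_i a 0 i * (v i == w)%:R.
pose eta (a : 'rV[R]_n.+1) := \sum_i a 0 i * ((v i != w)%:R * bform (v i) (v j0)).
have wlin (F : 'I_n.+1 -> R) : continuous (fun a : 'rV[R]_n.+1 => \sum_i a 0 i * F i).
  apply: continuous_sumr => i _; apply: continuous_mulr.
    exact: coord_continuous.
  exact: cst_continuous.
have alphac : continuous alpha by exact: wlin.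
have etac : continuous eta by exact: wlin.
have alpha1 : alpha a = 1.
  rewrite -a1; apply: eq_bigr => i _.
  by have [_|/zero ->] := eqVneq (v i) w; rewrite ?mulr1 ?mul0r.
have eta0 : eta a = 0.
  apply: big1 => i _; have [_|/zero ->] := eqVneq (v i) w; rewrite ?mul0r //=.
  by rewrite mulr0.
set beta := bform w (v j0).
have b0 : 0 < beta by apply: bform_neq_gt0 => //; rewrite eq_sym.
pose X (a : 'rV[R]_n.+1) := (1 + eta a / (2 * alpha a * beta)) ^+ 2.
have X1 : X a = 1 by rewrite /X eta0 mul0r addr0 expr1n.
have Xc : {for a, continuous X}.
  have Yc : {for a, continuous (fun a => 1 + eta a / (2 * alpha a * beta))}.
    apply: continuousD; first exact: cst_continuous.
    apply: continuousM; first exact: etac.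
    apply: continuousV; first by rewrite alpha1 mulr1 mulf_neq0 // gt_eqF.
    apply: continuousM; last exact: cst_continuous.
    by apply: continuousM; [exact: cst_continuous|exact: alphac].
  exact: (continuousM Yc Yc).
(* At [a] the bound [X] is 1, that is, distance 0, so any positive threshold below [r] holds
   nearby. *)
exists (r / 2); first by rewrite ltr_pdivrMr // ltr_pMr // ltr1n.
have nX : \forall a' \near a, arcosh_sqrt (X a') < r / 2.
  apply: near_lt_continuous; last by rewrite X1 arcosh_sqrt1 divr_gt0.
  by apply: (@continuous_comp _ _ _ X) => //; apply: arcosh_sqrt_continuous; rewrite X1.
have nA : \forall a' \near a, - alpha a' < 0.
  apply: near_lt_continuous; last by rewrite alpha1 oppr_lt0.
  by apply: continuousN; exact: alphac.
apply: filterS2 nX nA => a' lX; rewrite oppr_lt0 => al wa' ha'.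
have [q [sq hq le]] := near_ideal_vertex mn sv ww i0w j0w wa' ha' al.
apply: (bound _ q) => //; apply: le_trans (ltW lX).
have q1 := ratio_ge1 ha' hq.
by rewrite arcosh_sqrt_le //; exact: le_trans le.
Qed.

(** If a positive supremum [r] were not attained, every depth would be below [r]; compactness of the
    weights makes the local bounds of [depth_near] uniform, giving a bound below [r] for the
    supremum. *)
Lemma delta_attained m v : (0 < m < n)%N -> simplex v -> depths m v (delta m v).
Proof.
move=> mn sv; have [->|d0] := eqVneq (delta m v) 0%E; first by left.
have /andP[m0 mn'] := mn.
have [r rE] : exists r, delta m v = r%:E.
  have := delta_ge0 m v; have := delta_le mn sv.
  by case: (delta m v) => [r||] //; exists r.
have r0 : 0 < r.
  rewrite rE eqe in d0; rewrite lt0r d0 -lee_fin -rE; exact: delta_ge0.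
apply: contrapT => nd.
have lt_r a : weight [set: 'I_n.+1]%SET a -> Hyp (bary v a) ->
    (hdist_set (bary v a) (skeleton m v) < r%:E)%E.
  move=> wa ha; have da : depths m v (hdist_set (bary v a) (skeleton m v)).
    by right; exists (bary v a) => //; split=> //; apply/skeleton_top; exists a.
  rewrite -rE lt_neqAle; apply/andP; split; last exact: ereal_sup_ubound.
  by apply/eqP => e; apply: nd; rewrite -e.
have cover := (near_covering_withinP _).2
  ((compact_near_coveringP _).1 (@weight_compact R _ [set: 'I_n.+1]%SET)).
have near_r : \forall e \near r^'-, [set a | weight [set: 'I_n.+1]%SET a] `<=`
    (fun a => Hyp (bary v a) -> (hdist_set (bary v a) (skeleton m v) <= e%:E)%E).
  apply: (cover R r^'- (fun e a => Hyp (bary v a) ->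
    (hdist_set (bary v a) (skeleton m v) <= e%:E)%E)) => a wa.
  have mn'' : (0 < m <= n)%N by rewrite m0 ltnW.
  have [e er na] := depth_near mn'' sv r0 wa (lt_r _ wa).
  exists ([set a' | weight [set: 'I_n.+1]%SET a' -> Hyp (bary v a') ->
    (hdist_set (bary v a') (skeleton m v) <= e%:E)%E], [set e' | e < e']).
    by split=> //; exact: nbhs_left_gt.
  move=> [a' e'] /= [na' ee'] wa' ha'; apply: le_trans (na' wa' ha') _.
  by rewrite lee_fin ltW.
near (r^'-) => e.
have er : e < r by near: e; exact: nbhs_left_lt.
have e0 : 0 <= e by near: e; exact: nbhs_left_ge.
have le_e : [set a | weight [set: 'I_n.+1]%SET a] `<=`
    (fun a => Hyp (bary v a) -> (hdist_set (bary v a) (skeleton m v) <= e%:E)%E).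
  by near: e.
have : (delta m v <= e%:E)%E.
  apply: ge_ereal_sup => _ [->|[p [/skeleton_top[a wa pE] hp] <-]].
    by rewrite lee_fin.
  by rewrite pE in hp *; exact: le_e.
by rewrite rE lee_fin leNgt er.
Unshelve. all: by end_near. Qed.

End Attained.

(** * The case of edges and its limit *)

Section EdgeDepth.
Context {R : realType}.

Lemma extremal_ratio1 n : (0 < n)%N ->
  @extremal_ratio R n 1 = 2 * n%:R / n.+1%:R.
Proof.
move=> n0; have nR : 0 < n%:R :> R by rewrite ltr0n.
rewrite /extremal_ratio invr1 -natr1; field.
by rewrite gt_eqF //= gt_eqF // ltr_pwDr.
Qed.

Lemma extremal_ratio_cvg m :
  @extremal_ratio R n m @[n --> \oo] --> (1 + m%:R^-1 : R).
Proof.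
have inv0 : (n%:R^-1 : R) @[n --> \oo] --> (0 : R).
  rewrite -cvg_shiftS; exact: cvg_harmonic.
have den : (1 + n%:R^-1 : R) @[n --> \oo] --> (1 + 0 : R).
  by apply: cvgD inv0; exact: cvg_cst.
have -> : 1 + m%:R^-1 = (1 + m%:R^-1) / (1 + 0) :> R by rewrite addr0 divr1.
apply: cvgM; first exact: cvg_cst.
by apply: cvgV => //; rewrite addr0 oner_neq0.
Qed.

(** For [s = sqrt 2], [(s + 1) (s - 1) = 1], so [(s + 1) / (s - 1)] is the square of [1 + s]. *)
Lemma artanh_inv_sqrt2 : artanh (Num.sqrt (2 : R))^-1 = ln (1 + Num.sqrt 2).
Proof.
have s0 : 0 < Num.sqrt 2 :> R by rewrite sqrtr_gt0.
have ss : Num.sqrt 2 ^+ 2 = 2 :> R by rewrite sqr_sqrtr.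
set s := Num.sqrt 2 in s0 ss *.
have s1 : 1 < s by nra.
rewrite /artanh.
have -> : (1 + s^-1) / (1 - s^-1) = (1 + s) ^+ 2.
  have -> : (1 + s^-1) / (1 - s^-1) = (s + 1) / (s - 1).
    by field; rewrite subr_eq0 !gt_eqF.
  apply: (@mulIf _ (s - 1)); first by rewrite subr_eq0 gt_eqF.
  rewrite divfK ?subr_eq0 ?gt_eqF //.
  have -> : (1 + s) ^+ 2 * (s - 1) = (1 + s) * (s ^+ 2 - 1) by ring.
  by rewrite ss; ring.
by rewrite lnXn ?addr_gt0 // -[X in X / _ = _]mulr_natr mulfK ?pnatr_eq0.
Qed.

Lemma max_depth_limit : arcosh_sqrt (1 + 1%:R^-1) = ln (1 + Num.sqrt 2) :> R.
Proof.
rewrite invr1 /arcosh_sqrt /arcosh sqr_sqrtr // (_ : 1 + 1 - 1 = 1 :> R) ?addrK //.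
by rewrite sqrtr1 addrC.
Qed.

End EdgeDepth.

Theorem theorem1p4 (R : realType) :
  (forall n m : nat, (0 < m < n)%N ->
     (* the suprema defining delta and mu are maxima *)
     [/\ forall v : 'I_n.+1 -> 'rV[R]_n, simplex v -> depths m v (delta m v),
         exists2 v : 'I_n.+1 -> 'rV[R]_n, simplex v & delta m v = mu R n m &
         forall v : 'I_n.+1 -> 'rV[R]_n, simplex v ->
           (delta m v = mu R n m <-> [/\ total_simplex v, ideal_simplex v & regular_simplex v])]) /\
  (forall n : nat, (2 <= n)%N ->
     mu R n 1 \is a fin_num /\
     tanh (fine (mu R n 1)) ^+ 2 = (n%:R - 1) / (2 * n%:R)) /\
  (forall n n' : nat, (2 <= n)%N -> (n < n')%N -> (mu R n 1 < mu R n' 1)%E) /\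
  (mu R n 1 @[n --> \oo] --> (artanh (Num.sqrt (2 : R))^-1)%:E) /\
  artanh (Num.sqrt (2 : R))^-1 = ln (1 + Num.sqrt 2).
Proof.
split=> [n m mn|].
  have /andP[m0 mn'] := mn; have n1 : (1 < n)%N by exact: leq_ltn_trans mn'.
  have n0 := ltnW n1; split=> [v sv||v sv].
  - exact: delta_attained.
  - have bv := @std_simplex_balanced R n n0.
    exists std_simplex; first exact: ideal_is_simplex (balanced_ideal bv).
    by rewrite muE // balanced_delta.
  rewrite muE //; split=> [dv|[tv iv rv]].
    have bv := delta_max_balanced mn sv (delta_attained mn sv) dv.
    by split; [exact: balanced_total|exact: balanced_ideal|exact: balanced_regular].
  by apply: balanced_delta => //; exact: regular_balanced.
have mu1 n : (2 <= n)%N -> mu R n 1 = (@max_depth R n 1)%:E by move=> n2; exact: muE.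
split=> [n n2|].
  have n0 : (0 < n)%N by exact: ltnW.
  have nR : 0 < n%:R :> R by rewrite ltr0n.
  rewrite mu1 //; split=> //=.
  rewrite tanh_arcosh_sqrt; last exact: (@extremal_ratio_ge1 R n 1 n0).
  rewrite extremal_ratio1 // -natr1; field.
  by rewrite (gt_eqF nR) /= gt_eqF // ltr_pwDr.
split=> [n n' n2 nn'|].
  have n'2 : (2 <= n')%N by exact: leq_trans (ltnW nn').
  rewrite !mu1 // lte_fin; apply: arcosh_sqrt_lt.
    exact: (@extremal_ratio_ge1 R n 1 (ltnW n2)).
  have lt : n'%:R^-1 < n%:R^-1 :> R.
    by rewrite ltf_pV2 ?posrE ?ltr_nat // ltr0n ltnW.
  by rewrite /extremal_ratio ltr_pM2l // ltf_pV2 ?posrE ?ltrD2l // ltr_pwDl ?invr_ge0.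
split; last exact: artanh_inv_sqrt2.
(* The limit is expressed as the distance with squared hyperbolic cosine 2, the limit of the
   extremal ratios. *)
rewrite artanh_inv_sqrt2 -max_depth_limit.
have lim : @max_depth R n 1 @[n --> \oo] --> arcosh_sqrt (1 + 1%:R^-1).
  apply: (@cvg_comp _ _ _ (fun n => @extremal_ratio R n 1) arcosh_sqrt).
    exact: extremal_ratio_cvg.
  by apply: arcosh_sqrt_continuous; rewrite lerDl invr_ge0.
(* The formula for [mu R n 1] is available from [n = 2] on, so finiteness and equality are used
   eventually. *)
apply: cvg_EFin; first by exists 2%N => // n n2; rewrite /= mu1.
apply: cvg_trans lim; apply: near_eq_cvg; exists 2%N => // n n2.
by rewrite /= mu1.
Qed.
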